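(* For each prime $q$, let $R_0(q)$ and $G_\infty(q)=d_0(q)\,q^{2(R_0(q)-1)}$ be the quantities defined in the context. Then, as $q\to\infty$ through the primes, $$\lim_{q\to\infty} G_\infty(q)=\frac{1}{2\pi e}\qquad\text{and}\qquad \lim_{q\to\infty} R_0(q)=\frac12 .$$
   Context: For a prime $q$ and real numbers $x,y\in[0,q]$, define the cyclic metric $$\rho(x,y)=\min\{(x-y)^2,\,(|x-y|-q)^2\},$$ and for $s\in\mathbb{R}$ and $x\in[0,q]$ define $$g(s,x)=\frac1q\sum_{k=0}^{q-1}e^{s\rho(x,k)} .$$ Let $d_0=d_0(q)>0$ denote a solution $d$ of the equation $$d=2\int_0^{1/2}\frac{\frac{\partial}{\partial s}g(s,x)}{g(s,x)}\,dx\;\Bigg|_{s=-\frac{1}{2d}},$$ and define $$R_0(q)=\frac{1}{\ln q}\left(-\frac12-2\int_0^{1/2}\ln g\!\left(-\frac{1}{2d_0},x\right)dx\right).$$ Define $G_\infty(q)=d_0(q)\,q^{2(R_0(q)-1)}$. Interpretation (not needed to state the result): for a $q$-ary linear code $C$ of length $n$, let $\Lambda(C)=\{\lambda\in\mathbb{Z}^n : \exists\, c\in C,\ \lambda\equiv c \pmod q\}$, and let $\mathcal{R}$ be the Voronoi region of the origin in this lattice. The normalized second moment of the lattice is $\frac1n\int_{\mathcal{R}}\|x\|^2dx\,/\,\mathrm{vol}(\mathcal{R})^{1+2/n}$. It is a previously known theorem that for every $\varepsilon>0$ there is a sequence of $q$-ary linear codes $C_n$ of length $n$ such that the normalized second moments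 $G_n(q)$ of $\Lambda(C_n)$ satisfy $|G_n(q)-d_0q^{2(R_0(q)-1)}|<\varepsilon$ for all sufficiently large $n$. In this sense $G_\infty(q)$ is the limiting value $\lim_{n\to\infty}G_n(q)$. *)

(* Defs.v *)
From Stdlib Require Export Reals ZArith Znumtheory.
From Coquelicot Require Export Coquelicot.
Open Scope R_scope.

Definition rho (q : nat) (x y : R) : R :=
  Rmin ((x - y) ^ 2) ((Rabs (x - y) - INR q) ^ 2).

(* [sum_f_R0 f N] has N + 1 terms, so k runs over 0, ..., q - 1 when q >= 1. *)
Definition g (q : nat) (s x : R) : R :=
  / INR q * sum_f_R0 (fun k => exp (s * rho q x (INR k))) (q - 1).

(* The defining equation is not assumed to have only one positive root: this is
   a predicate on d, and [R_0] and [G_infty] take the chosen root as argument. *)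
Definition is_d0 (q : nat) (d : R) : Prop :=
  0 < d /\
  d = 2 * RInt (fun x => Derive (fun s => g q s x) (- (1 / (2 * d)))
                         / g q (- (1 / (2 * d))) x) 0 (1 / 2).

Definition R_0 (q : nat) (d0 : R) : R :=
  1 / ln (INR q) *
  (- (1 / 2) - 2 * RInt (fun x => ln (g q (- (1 / (2 * d0))) x)) 0 (1 / 2)).

Definition G_infty (q : nat) (d0 : R) : R :=
  d0 * Rpower (INR q) (2 * (R_0 q d0 - 1)).

Definition prime_nat (q : nat) : Prop := prime (Z.of_nat q).

Definition primes_to_infty : (nat -> Prop) -> Prop := within prime_nat eventually.

(* Main.v *)
Require Import Defs.
From Stdlib Require Import Lra Lia Psatz.

(* For q = 2m+1 and 0 <= x <= 1/2, q g(-1/(2d), x) is the truncated theta sum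
   S(x) = sum_{|j| <= m} exp(-(x+j)^2/(2d)).  Let M be the same sum weighted by x+j, so that
   S' = -M/d, and h = M/S.  Integrating h' turns the equation for d into
     d h(1/2) = int_0^{1/2} h^2,  with  M(1/2) = (q/2) exp(-q^2/(8d)) =: b.
   M satisfies M_d = M''/2 + 3M/(2d), a heat equation in d, which locates every root d:
   - if d >= 2q, an energy estimate for M - 2xb makes int h^2 exponentially close to O(b^2),
     too small for the equation;
   - if d <= q/40, the first sine coefficient of M, whose decay in d is explicit, makes
     int h^2 exceed d h(1/2).
   So q/40 < d < 2q.  Then (ln S)' = -h/d is small, S(x) is close to S(0), and S(0) is close to
   the Gaussian integral sqrt(2 pi d), so 2 int ln S = ln(2 pi d)/2 + o(1).  Finally
   ln G_infty = ln d - 1 - 4 int ln S and R_0 = 1 - (1/2 + 2 int ln S)/ln q. *)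

(** * Symmetric sums and truncated Gaussian moments *)

(** Near its roots both sides of the equation for d are exponentially small, so a root is located by
    comparing exponents. The left side carries exp(-q^2/(8d)); the first sine mode of M decays like
    exp(-2 pi^2 d), and the right side is quadratic in M. Heuristically the exponents q^2/(8d) and 4
    pi^2 d balance at d = q/(4 sqrt(2) pi), about q/17.8, well inside the window from q/40 to 2q;
    this is why the constants below can be wasteful. A window of bounded ratio suffices: d cancels
    from [G_infty] once 2 int ln S is known up to o(1), and [R_0] only needs ln d = ln q + O(1).
    Neither uniqueness nor an asymptotic formula for the root enters. With d as time, the heat
    equation is studied on [0, 1/2], where M vanishes on the left by oddness and equals b on the
    right. *)

Lemma is_derive_RInt_param' (f df : R -> R -> R) (a b x : R) :
  locally x (fun y => forall t, is_derive (fun u => f u t) y (df y t)) ->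
  (forall t, continuity_2d_pt df x t) ->
  locally x (fun y => forall t, continuous (f y) t) ->
  is_derive (fun y => RInt (f y) a b) x (RInt (df x) a b).
Proof.
  intros Hd Hc Hf.
  replace (RInt (df x) a b) with (RInt (fun t => Derive (fun u => f u t) x) a b).
  2:{ apply RInt_ext; intros t _; apply is_derive_unique.
      exact (locally_singleton _ _ Hd t). }
  apply is_derive_RInt_param.
  - revert Hd; apply filter_imp; intros y H t _; eexists; apply H.
  - intros t _. apply (continuity_2d_pt_ext_loc df); [|apply Hc].
    destruct Hd as [e He]. exists e; intros u v Hu _.
    symmetry; apply is_derive_unique, He, Hu.
  - revert Hf; apply filter_imp; intros y H.
    apply (ex_RInt_continuous (V := R_CompleteNormedModule)); intros; apply H.
Qed.

(** Shifts are added in pairs [+j], [-j], so that parity arguments and termwise calculus become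
    inductions on [m]. *)
Fixpoint psum (f : R -> R) (m : nat) (x : R) : R :=
  match m with
  | O => f x
  | S n => psum f n x + (f (x + INR (S n)) + f (x - INR (S n)))
  end.

Lemma psum_ext (f h : R -> R) (m : nat) (x : R) :
  (forall y, f y = h y) -> psum f m x = psum h m x.
Proof. intros H; induction m as [|m IH]; cbn [psum]; now rewrite ?IH, !H. Qed.

Lemma psum_bounds (f : R -> R) (m : nat) (a b x : R) :
  -1/2 <= x <= 1/2 ->
  (forall y, Rabs y <= INR m + 1/2 -> a <= f y <= b) ->
  (2 * INR m + 1) * a <= psum f m x <= (2 * INR m + 1) * b.
Proof.
  intros Hx; induction m as [|m IH]; intros H; cbn [psum].
  - simpl in *; assert (a <= f x <= b) by (apply H, Rabs_le; lra); lra.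
  - assert (Hm := pos_INR m). rewrite S_INR in *.
    assert (a <= f (x + (INR m + 1)) <= b) by (apply H, Rabs_le; lra).
    assert (a <= f (x - (INR m + 1)) <= b) by (apply H, Rabs_le; lra).
    assert ((2 * INR m + 1) * a <= psum f m x <= (2 * INR m + 1) * b).
    { apply IH; intros y Hy; apply H; lra. }
    lra.
Qed.

Lemma psum_odd_0 (f : R -> R) (m : nat) :
  (forall y, f (- y) = - f y) -> psum f m 0 = 0.
Proof.
  intros H; induction m as [|m IH]; cbn [psum].
  - specialize (H 0); rewrite Ropp_0 in H; lra.
  - rewrite IH. replace (0 - INR (S m)) with (- (0 + INR (S m))) by ring.
    rewrite H; ring.
Qed.

(** The reflection y -> -y sends 1/2 + j to 1/2 + (-1 - j), so among |j| <= m only j = m stays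
    unpaired. *)
Lemma psum_odd_half (f : R -> R) (m : nat) :
  (forall y, f (- y) = - f y) -> psum f m (1/2) = f (1/2 + INR m).
Proof.
  intros H; induction m as [|m IH]; cbn [psum].
  - simpl; f_equal; ring.
  - rewrite IH. replace (1/2 - INR (S m)) with (- (1/2 + INR m)) by (rewrite S_INR; field).
    rewrite H; ring.
Qed.

Lemma is_derive_psum (f df : R -> R) (m : nat) (x : R) :
  (forall y, is_derive f y (df y)) -> is_derive (psum f m) x (psum df m x).
Proof.
  intros H; revert x; induction m as [|m IH]; intros x; cbn [psum]; [apply H|].
  apply (is_derive_plus (V := R_NormedModule)); [apply IH|].
  apply (is_derive_plus (V := R_NormedModule)).
  - replace (df (x + INR (S m))) with (scal 1 (df (x + INR (S m)))).
    2:{ unfold scal; simpl; unfold mult; simpl; ring. }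
    apply (is_derive_comp f (fun x => x + INR (S m))); [apply H|].
    auto_derive; trivial; ring.
  - replace (df (x - INR (S m))) with (scal 1 (df (x - INR (S m)))).
    2:{ unfold scal; simpl; unfold mult; simpl; ring. }
    apply (is_derive_comp f (fun x => x - INR (S m))); [apply H|].
    auto_derive; trivial; ring.
Qed.

Lemma is_derive_psum_param (F : R -> R -> R) (dF : R -> R) (m : nat) (d x : R) :
  (forall y, is_derive (fun u => F u y) d (dF y)) ->
  is_derive (fun u => psum (F u) m x) d (psum dF m x).
Proof.
  intros H; induction m as [|m IH]; cbn [psum]; [apply H|].
  apply (is_derive_plus (V := R_NormedModule)); [apply IH|].
  apply (is_derive_plus (V := R_NormedModule)); apply H.
Qed.

Lemma continuity_2d_pt_shift (F : R -> R -> R) (d x c : R) :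
  continuity_2d_pt F d (x + c) -> continuity_2d_pt (fun u v => F u (v + c)) d x.
Proof.
  intros H eps; destruct (H eps) as [e He]; exists e; intros u v Hu Hv.
  apply He; [exact Hu|]. now replace (v + c - (x + c)) with (v - x) by ring.
Qed.

Lemma continuity_2d_pt_psum (F : R -> R -> R) (m : nat) (d x : R) :
  (forall y, continuity_2d_pt F d y) ->
  continuity_2d_pt (fun u v => psum (F u) m v) d x.
Proof.
  intros H; induction m as [|m IH]; cbn [psum]; [apply H|].
  apply continuity_2d_pt_plus; [apply IH|].
  apply continuity_2d_pt_plus; apply (continuity_2d_pt_shift F); apply H.
Qed.

(** S and M are the cases k = 0 and k = 1. Differentiation in [x] or in [d] only shifts [k], which
    reduces the heat equation to algebra between moments. *)
Definition mom (m k : nat) (d x : R) : R :=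
  psum (fun y => y ^ k * exp (- (y ^ 2 / (2 * d)))) m x.

Lemma is_derive_mom_x (m k : nat) (d x : R) : 0 < d ->
  is_derive (mom m k d) x (INR k * mom m (pred k) d x - mom m (S k) d x / d).
Proof.
  intros Hd; unfold mom.
  replace (INR k * psum _ m x - psum _ m x / d) with
    (psum (fun y => INR k * (y ^ pred k * exp (- (y ^ 2 / (2 * d))))
        - y ^ S k * exp (- (y ^ 2 / (2 * d))) / d) m x).
  - apply is_derive_psum; intros y; auto_derive; trivial.
    unfold Rdiv; cbn [pow]; field; lra.
  - clear; revert x; induction m as [|m IH]; intros x; cbn [psum]; [reflexivity|].
    rewrite IH; unfold Rdiv; ring.
Qed.

Lemma is_derive_mom_d (m k : nat) (d x : R) : 0 < d ->
  is_derive (fun u => mom m k u x) d (mom m (S (S k)) d x / (2 * d ^ 2)).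
Proof.
  intros Hd; unfold mom.
  replace (psum _ m x / (2 * d ^ 2)) with
    (psum (fun y => y ^ S (S k) * exp (- (y ^ 2 / (2 * d))) / (2 * d ^ 2)) m x).
  - apply (is_derive_psum_param (fun u y => y ^ k * exp (- (y ^ 2 / (2 * u))))).
    intros y; auto_derive; [lra|]. unfold Rdiv; cbn [pow]; field; lra.
  - clear; induction m as [|m IH]; cbn [psum]; [reflexivity|].
    rewrite IH; unfold Rdiv; ring.
Qed.

Lemma continuity_2d_pt_mom (m k : nat) (d x : R) : 0 < d ->
  continuity_2d_pt (mom m k) d x.
Proof.
  intros Hd; unfold mom.
  apply (continuity_2d_pt_psum (fun d y => y ^ k * exp (- (y ^ 2 / (2 * d))))); intros y.
  apply continuity_2d_pt_mult.
  - apply (continuity_1d_2d_pt_comp (fun y => y ^ k) (fun _ v => v)).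
    + apply derivable_continuous_pt, derivable_pt_pow.
    + apply continuity_2d_pt_id2.
  - apply (continuity_1d_2d_pt_comp exp (fun u v => - (v ^ 2 / (2 * u)))).
    + apply derivable_continuous_pt, derivable_pt_exp.
    + apply continuity_2d_pt_opp, continuity_2d_pt_mult.
      * apply (continuity_1d_2d_pt_comp (fun y => y ^ 2) (fun _ v => v)).
        -- apply derivable_continuous_pt, derivable_pt_pow.
        -- apply continuity_2d_pt_id2.
      * apply continuity_2d_pt_inv; [|lra].
        apply continuity_2d_pt_mult; [apply continuity_2d_pt_const|apply continuity_2d_pt_id1].
Qed.

Lemma continuous_mom (m k : nat) (d x : R) : 0 < d -> continuous (mom m k d) x.
Proof.
  intros Hd; apply (ex_derive_continuous (V := R_NormedModule)); eexists.
  now apply is_derive_mom_x.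
Qed.

Lemma mom_0_gt0 (m : nat) (d x : R) : 0 < mom m 0 d x.
Proof.
  unfold mom; induction m as [|m IH]; cbn [psum pow]; rewrite !Rmult_1_l.
  - apply exp_pos.
  - cbn [pow] in IH. assert (H1 := exp_pos (- ((x + INR (S m)) ^ 2 / (2 * d)))).
    assert (H2 := exp_pos (- ((x - INR (S m)) ^ 2 / (2 * d)))).
    cbn [pow] in H1, H2; lra.
Qed.

Lemma mom_1_0 (m : nat) (d : R) : mom m 1 d 0 = 0.
Proof.
  apply psum_odd_0; intros y; replace ((- y) ^ 2) with (y ^ 2) by ring; ring.
Qed.

Definition bdry (m : nat) (d : R) : R :=
  (INR m + 1/2) * exp (- ((INR m + 1/2) ^ 2 / (2 * d))).

Lemma mom_1_half (m : nat) (d : R) : mom m 1 d (1/2) = bdry m d.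
Proof.
  unfold mom; rewrite psum_odd_half.
  - rewrite pow_1, (Rplus_comm (1/2)); reflexivity.
  - intros y; replace ((- y) ^ 2) with (y ^ 2) by ring; ring.
Qed.

(** * The equation for d *)

(** Matches the order of the residues 0, ..., q - 1 with m = n + 1: k <= m is the shift -k, and k =
    m + 1 + i is the shift q - k = m - i. The index is a successor because [sum_f_R0] always has at
    least one term. *)
Lemma psum_sum_f_R0 (f : R -> R) (n : nat) (x : R) :
  psum f (S n) x = sum_f_R0 (fun k => f (x - INR k)) (S n)
                   + sum_f_R0 (fun i => f (x + INR (S n) - INR i)) n.
Proof.
  induction n as [|n IH].
  - simpl; rewrite !Rminus_0_r; ring.
  - rewrite (decomp_sum (fun i => f (x + INR (S (S n)) - INR i)) (S n)) by lia.
    change (psum f (S (S n)) x) with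
      (psum f (S n) x + (f (x + INR (S (S n))) + f (x - INR (S (S n))))).
    rewrite IH, (tech5 _ (S n)); cbn [pred].
    rewrite (sum_eq (fun i => f (x + INR (S (S n)) - INR (S i)))
                    (fun i => f (x + INR (S n) - INR i))).
    + change (INR 0) with 0; rewrite Rminus_0_r; ring.
    + intros i _; f_equal; rewrite (S_INR (S n)), (S_INR i); ring.
Qed.

Lemma INR_odd (m : nat) : INR (2 * m + 1) = 2 * INR m + 1.
Proof. rewrite plus_INR, mult_INR; simpl; ring. Qed.

Lemma Rmin_cyclic (a c : R) : 0 <= a <= c / 2 -> Rmin (a ^ 2) ((a - c) ^ 2) = a ^ 2.
Proof. intros H; apply Rmin_left; nra. Qed.

Lemma Rmin_cyclic' (a c : R) : c / 2 <= a <= c -> Rmin (a ^ 2) ((a - c) ^ 2) = (a - c) ^ 2.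
Proof. intros H; apply Rmin_right; nra. Qed.

(** For x in [0, 1/2] the residues k <= m lie within q/2 of x and all others are nearer going round
    the cycle, so each [Rmin] is decided by its index. *)
Lemma g_psum (m : nat) (s x : R) : (1 <= m)%nat -> 0 <= x <= 1/2 ->
  g (2 * m + 1) s x = / INR (2 * m + 1) * psum (fun y => exp (s * y ^ 2)) m x.
Proof.
  intros Hm Hx; unfold g; f_equal.
  destruct m as [|n]; [lia|]. rewrite psum_sum_f_R0.
  rewrite (tech2 _ (S n) (2 * S n + 1 - 1)) by lia.
  replace (2 * S n + 1 - 1 - S (S n))%nat with n by lia.
  unfold rho; rewrite INR_odd.
  assert (Hn := pos_INR n).
  f_equal; apply sum_eq; intros i Hi; apply (f_equal exp); f_equal; apply le_INR in Hi;
    assert (Hi0 := pos_INR i).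
  - rewrite <- (pow2_abs (x - INR i)). apply Rmin_cyclic.
    split; [apply Rabs_pos|]. apply Rabs_le; lra.
  - rewrite <- (pow2_abs (x - _)). rewrite plus_INR, Rabs_left by (rewrite !S_INR; lra).
    rewrite !S_INR in *. rewrite Rmin_cyclic' by lra. ring.
Qed.

Lemma psum_exp_mom (m : nat) (d x : R) : 0 < d ->
  psum (fun y => exp (- (1 / (2 * d)) * y ^ 2)) m x = mom m 0 d x.
Proof.
  intros Hd; apply psum_ext; intros y; rewrite pow_O, Rmult_1_l; f_equal; field; lra.
Qed.

Lemma g_mom (m : nat) (d x : R) : (1 <= m)%nat -> 0 < d -> 0 <= x <= 1/2 ->
  g (2 * m + 1) (- (1 / (2 * d))) x = / INR (2 * m + 1) * mom m 0 d x.
Proof. intros Hm Hd Hx; rewrite g_psum, psum_exp_mom by assumption; reflexivity. Qed.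

Lemma Derive_g_mom (m : nat) (d x : R) : (1 <= m)%nat -> 0 < d -> 0 <= x <= 1/2 ->
  Derive (fun s => g (2 * m + 1) s x) (- (1 / (2 * d)))
  = / INR (2 * m + 1) * mom m 2 d x.
Proof.
  intros Hm Hd Hx.
  rewrite (Derive_ext _ (fun s => / INR (2 * m + 1) * psum (fun y => exp (s * y ^ 2)) m x))
    by (intros; now apply g_psum).
  rewrite Derive_scal; f_equal; apply is_derive_unique.
  replace (mom m 2 d x) with
    (psum (fun y => y ^ 2 * exp (- (1 / (2 * d)) * y ^ 2)) m x).
  - apply (is_derive_psum_param (fun s y => exp (s * y ^ 2))); intros y.
    auto_derive; trivial; cbn [pow]; ring.
  - apply psum_ext; intros y; f_equal; f_equal; field; lra.
Qed.

(** * Integrals and continuity of real functions *)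

Lemma RInt_ext_le (f h : R -> R) (a b : R) : a <= b ->
  (forall x, a < x < b -> f x = h x) -> RInt f a b = RInt h a b.
Proof.
  intros Hab H; apply RInt_ext; intros x Hx.
  rewrite Rmin_left, Rmax_right in Hx by exact Hab; now apply H.
Qed.

Lemma ex_RInt_cont (f : R -> R) (a b : R) : (forall x, continuous f x) -> ex_RInt f a b.
Proof. intros H; apply (ex_RInt_continuous (V := R_CompleteNormedModule)); auto. Qed.

Lemma RInt_deriv (f df : R -> R) (a b : R) :
  (forall x, is_derive f x (df x)) -> (forall x, continuous df x) ->
  RInt df a b = f b - f a.
Proof.
  intros H1 H2; apply is_RInt_unique.
  apply (is_RInt_derive f df); auto.
Qed.

Lemma RInt_cst (a b c : R) : RInt (fun _ => c) a b = (b - a) * c.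
Proof. rewrite RInt_const; reflexivity. Qed.

Lemma RInt_plus_cont (f h : R -> R) (a b : R) :
  (forall x, continuous f x) -> (forall x, continuous h x) ->
  RInt (fun x => f x + h x) a b = RInt f a b + RInt h a b.
Proof. intros; apply (RInt_plus (V := R_CompleteNormedModule)); now apply ex_RInt_cont. Qed.

Lemma RInt_scal_cont (f : R -> R) (c a b : R) : (forall x, continuous f x) ->
  RInt (fun x => c * f x) a b = c * RInt f a b.
Proof. intros; apply (RInt_scal (V := R_CompleteNormedModule)); now apply ex_RInt_cont. Qed.

Lemma RInt_le_cont (f h : R -> R) (a b : R) : a <= b ->
  (forall x, continuous f x) -> (forall x, continuous h x) ->
  (forall x, a < x < b -> f x <= h x) -> RInt f a b <= RInt h a b.
Proof. intros; apply RInt_le; auto using ex_RInt_cont. Qed.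

Lemma continuous_Rplus (f h : R -> R) (x : R) :
  continuous f x -> continuous h x -> continuous (fun y => f y + h y) x.
Proof. apply (continuous_plus (V := R_NormedModule)). Qed.

Lemma continuous_Rminus (f h : R -> R) (x : R) :
  continuous f x -> continuous h x -> continuous (fun y => f y - h y) x.
Proof. apply (continuous_minus (V := R_NormedModule)). Qed.

Lemma continuous_Rmult (f h : R -> R) (x : R) :
  continuous f x -> continuous h x -> continuous (fun y => f y * h y) x.
Proof. apply (continuous_mult (K := R_AbsRing)). Qed.

Lemma continuous_Rpow (f : R -> R) (n : nat) (x : R) :
  continuous f x -> continuous (fun y => f y ^ n) x.
Proof.
  intros H; induction n as [|n IH]; cbn [pow]; [apply continuous_const|].
  now apply continuous_Rmult.
Qed.

Lemma continuous_inv (f : R -> R) (x : R) :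
  continuous f x -> f x <> 0 -> continuous (fun y => / f y) x.
Proof. intros H1 H2; apply (continuous_comp f Rinv); [exact H1|now apply continuous_Rinv]. Qed.

Lemma continuous_div_mom (f : R -> R) (m : nat) (d x : R) : 0 < d ->
  continuous f x -> continuous (fun y => f y / mom m 0 d y) x.
Proof.
  intros Hd H; apply continuous_Rmult; [exact H|].
  apply continuous_inv; [now apply continuous_mom|].
  assert (H0 := mom_0_gt0 m d x); lra.
Qed.

(** * The equation in terms of the mean h = M/S *)

(** The mean of the points x + j under the Gaussian weights; its derivative is therefore 1 minus
    their variance over [d]. *)
Definition cmean (m : nat) (d x : R) : R := mom m 1 d x / mom m 0 d x.

Lemma cmean_0 (m : nat) (d : R) : cmean m d 0 = 0.
Proof. unfold cmean; rewrite mom_1_0; apply Rmult_0_l. Qed.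

Lemma cmean_half (m : nat) (d : R) : cmean m d (1/2) = bdry m d / mom m 0 d (1/2).
Proof. unfold cmean; now rewrite mom_1_half. Qed.

Lemma continuous_cmean (m : nat) (d x : R) : 0 < d -> continuous (cmean m d) x.
Proof. intros Hd; now apply (continuous_div_mom (mom m 1 d)), continuous_mom. Qed.

Lemma is_derive_cmean (m : nat) (d x : R) : 0 < d ->
  is_derive (cmean m d) x
    (1 - mom m 2 d x / mom m 0 d x / d + cmean m d x ^ 2 / d).
Proof.
  intros Hd. assert (H0 := mom_0_gt0 m d x).
  unfold cmean.
  replace (1 - _ + _) with
    (((INR 1 * mom m 0 d x - mom m 2 d x / d) * mom m 0 d x
      - mom m 1 d x * (INR 0 * mom m 0 d x - mom m 1 d x / d)) / mom m 0 d x ^ 2).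
  - apply is_derive_div; [apply (is_derive_mom_x m 1)|apply (is_derive_mom_x m 0)|]; lra.
  - simpl; field; lra.
Qed.

(** Differentiating in [s] brings down the square of x + j and the factors 1/q cancel: the weighted
    mean square, averaged over [0, 1/2], equals [d]. *)
Lemma is_d0_mom (m : nat) (d : R) : (1 <= m)%nat -> is_d0 (2 * m + 1) d ->
  0 < d /\ d = 2 * RInt (fun x => mom m 2 d x / mom m 0 d x) 0 (1/2).
Proof.
  intros Hm [Hd H]; split; [exact Hd|]. rewrite H at 1; f_equal.
  apply RInt_ext_le; [lra|]; intros x Hx.
  rewrite Derive_g_mom, g_mom by (auto; lra).
  assert (H0 := mom_0_gt0 m d x).
  assert (H1 := pos_INR m).
  rewrite INR_odd; field; lra.
Qed.

Ltac cont := repeat (intros; match goal with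
  | |- continuous (fun _ => ?c) _ => apply continuous_const
  | |- continuous (Rmult ?c) _ => apply (continuous_Rmult (fun _ => c) (fun y => y))
  | |- continuous (fun x => x) _ => apply continuous_id
  | |- continuous (fun x => _ + _) _ => apply continuous_Rplus
  | |- continuous (fun x => _ - _) _ => apply continuous_Rminus
  | |- continuous (fun x => _ / mom _ 0 _ x) _ => apply continuous_div_mom; [assumption|]
  | |- continuous (fun x => _ / _) _ => apply continuous_Rmult
  | |- continuous (fun x => _ * _) _ => apply continuous_Rmult
  | |- continuous (fun x => _ ^ _) _ => apply continuous_Rpow
  | |- continuous (mom _ _ _) _ => apply continuous_mom; assumption
  | |- continuous (fun x => mom _ _ _ x) _ => apply continuous_mom; assumption
  | |- continuous (cmean _ _) _ => apply continuous_cmean; assumption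
  | |- continuous (fun x => cmean _ _ x) _ => apply continuous_cmean; assumption
  end).

(* Integrate [is_derive_cmean] over [0, 1/2]. *)
Lemma is_d0_cmean (m : nat) (d : R) : (1 <= m)%nat -> is_d0 (2 * m + 1) d ->
  d * (bdry m d / mom m 0 d (1/2)) = RInt (fun x => cmean m d x ^ 2) 0 (1/2).
Proof.
  intros Hm [Hd H]%is_d0_mom; [|exact Hm].
  assert (E := RInt_deriv (cmean m d) _ 0 (1/2) (fun x => is_derive_cmean m d x Hd)).
  rewrite (RInt_ext_le _ (fun x => 1 + (- / d) * (mom m 2 d x / mom m 0 d x)
                           + / d * cmean m d x ^ 2)) in E.
  2: lra.
  2: { intros x _; assert (H0 := mom_0_gt0 m d x); field; lra. }
  rewrite !RInt_plus_cont, !RInt_scal_cont, RInt_cst in E by cont.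
  rewrite cmean_0, cmean_half in E.
  replace (RInt (fun x => mom m 2 d x / mom m 0 d x) 0 (1/2)) with (d / 2) in E by lra.
  assert (H0 := mom_0_gt0 m d (1/2)).
  replace (bdry m d / mom m 0 d (1/2))
    with (bdry m d / mom m 0 d (1/2) - 0) by ring.
  rewrite <- E by cont. field; lra.
Qed.

Lemma RInt_sqr_half : RInt (fun x => x ^ 2) 0 (1/2) = 1/24 :> R.
Proof.
  rewrite (RInt_deriv (fun x => x ^ 3 / 3) (fun x => x ^ 2)); [field| |cont].
  intros x; auto_derive; trivial; field.
Qed.

(** All points x + j with |x| <= 1/2 satisfy (x + j)^2 >= x^2, so the mean square is at least x^2.
    This first bound, uniform in [m], keeps the later estimates away from d = 0. *)
Lemma is_d0_ge (m : nat) (d : R) : (1 <= m)%nat -> is_d0 (2 * m + 1) d -> 1/12 <= d.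
Proof.
  intros Hm [Hd H]%is_d0_mom; [|exact Hm].
  assert (L : RInt (fun x => x ^ 2) 0 (1/2) <= RInt (fun x => mom m 2 d x / mom m 0 d x) 0 (1/2)).
  { apply RInt_le_cont; [lra|cont|cont|]. intros x Hx.
    assert (H0 := mom_0_gt0 m d x). apply (proj1 (Rle_div_r _ _ _ H0)); clear H0.
    unfold mom; clear -Hx; induction m as [|m IH]; cbn [psum].
    - right; ring.
    - rewrite !Rmult_plus_distr_l; apply Rplus_le_compat; [exact IH|].
      rewrite pow_O, !Rmult_1_l.
      assert (Hm := pos_INR m).
      apply Rplus_le_compat; apply Rmult_le_compat_r;
        try (left; apply exp_pos); rewrite S_INR; nra. }
  rewrite RInt_sqr_half in L; lra.
Qed.

(** * Upper bound on d *)

Lemma nonincreasing_of_derive (f df : R -> R) (a b : R) : a <= b ->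
  (forall x, a <= x <= b -> is_derive f x (df x)) ->
  (forall x, a <= x <= b -> df x <= 0) -> f b <= f a.
Proof.
  intros Hab Hd Hn.
  destruct (MVT_gen f a b df) as [c [Hc E]].
  - intros x Hx; rewrite Rmin_left, Rmax_right in Hx by exact Hab; apply Hd; lra.
  - intros x Hx; rewrite Rmin_left, Rmax_right in Hx by exact Hab.
    apply continuity_pt_filterlim, (ex_derive_continuous (V := R_NormedModule)).
    eexists; apply Hd; lra.
  - rewrite Rmin_left, Rmax_right in Hc by exact Hab.
    specialize (Hn c Hc); nra.
Qed.

Lemma locally_gt0 (d : R) (P : R -> Prop) : 0 < d -> (forall y, 0 < y -> P y) -> locally d P.
Proof.
  intros Hd H; exists (mkposreal d Hd); intros y Hy; apply H.
  unfold ball in Hy; simpl in Hy; unfold AbsRing_ball, abs, minus, plus, opp in Hy; simpl in Hy.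
  apply Rabs_def2 in Hy; lra.
Qed.

Lemma bdry_gt0 (m : nat) (d : R) : 0 < bdry m d.
Proof.
  apply Rmult_lt_0_compat; [assert (H := pos_INR m); lra|apply exp_pos].
Qed.

Lemma is_derive_bdry (m : nat) (d : R) : 0 < d ->
  is_derive (bdry m) d (bdry m d * (INR m + 1/2) ^ 2 / (2 * d ^ 2)).
Proof.
  intros Hd; unfold bdry; auto_derive; [lra|].
  unfold Rdiv; cbn [pow]; field; lra.
Qed.

Lemma continuity_2d_pt_fst (f : R -> R) (d x : R) : continuous f d ->
  continuity_2d_pt (fun u _ => f u) d x.
Proof.
  intros H; apply (continuity_1d_2d_pt_comp f (fun u _ => u)).
  - now apply continuity_pt_filterlim.
  - apply continuity_2d_pt_id1.
Qed.

Lemma continuous_bdry (m : nat) (d : R) : 0 < d -> continuous (bdry m) d.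
Proof.
  intros Hd; apply (ex_derive_continuous (V := R_NormedModule)); eexists.
  now apply is_derive_bdry.
Qed.

(** Subtracting the linear interpolation of the end values 0 and b gives Dirichlet conditions on
    [0, 1/2]. *)
Definition lifted (m : nat) (d x : R) : R := mom m 1 d x - 2 * x * bdry m d.

Definition energy (m : nat) (d : R) : R := RInt (fun x => lifted m d x ^ 2) 0 (1/2).

Definition lifted_d (m : nat) (d x : R) : R :=
  mom m 3 d x / (2 * d ^ 2) - 2 * x * (bdry m d * (INR m + 1/2) ^ 2 / (2 * d ^ 2)).

Lemma is_derive_lifted_d (m : nat) (d x : R) : 0 < d ->
  is_derive (fun u => lifted m u x) d (lifted_d m d x).
Proof.
  intros Hd; apply (is_derive_minus (V := R_NormedModule)).
  - now apply is_derive_mom_d.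
  - apply is_derive_scal, is_derive_bdry, Hd.
Qed.

Lemma continuous_lifted (m : nat) (d x : R) : 0 < d -> continuous (lifted m d) x.
Proof. intros Hd; unfold lifted; cont. Qed.

Lemma continuous_lifted_d (m : nat) (d x : R) : 0 < d -> continuous (lifted_d m d) x.
Proof. intros Hd; unfold lifted_d; cont. Qed.

Lemma is_derive_energy (m : nat) (d : R) : 0 < d ->
  is_derive (energy m) d (RInt (fun x => 2 * lifted m d x * lifted_d m d x) 0 (1/2)).
Proof.
  intros Hd; unfold energy.
  apply (is_derive_RInt_param' (fun d x => lifted m d x ^ 2)
           (fun d x => 2 * lifted m d x * lifted_d m d x)).
  - apply locally_gt0; [exact Hd|]; intros y Hy t.
    replace (2 * lifted m y t * lifted_d m y t)
      with (INR 2 * lifted_d m y t * lifted m y t ^ pred 2) by (simpl; ring).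
    apply (is_derive_pow (fun u => lifted m u t)), is_derive_lifted_d, Hy.
  - intros t; unfold lifted, lifted_d, Rdiv.
    assert (C1 := fun k => continuity_2d_pt_mom m k d t Hd).
    assert (C2 : continuity_2d_pt (fun u _ => bdry m u) d t)
      by now apply continuity_2d_pt_fst, continuous_bdry.
    assert (C3 : continuity_2d_pt (fun u _ => / (2 * u ^ 2)) d t).
    { apply (continuity_2d_pt_fst (fun u => / (2 * u ^ 2))).
      apply continuous_inv; [cont|nra]. }
    assert (C4 := continuity_2d_pt_id2 d t).
    repeat (first [apply C1 | apply C2 | apply C3 | apply C4
                  | apply continuity_2d_pt_const
                  | apply continuity_2d_pt_mult | apply continuity_2d_pt_minus]).
  - apply locally_gt0; [exact Hd|]; intros y Hy t.
    apply continuous_Rpow, continuous_lifted, Hy.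
Qed.

(* Put [w = lifted m d] and [p x = 8 x - 2].  As [w] vanishes at both ends,
   [w w''] and [- (w' + p w)^2 - (p' - p^2) w^2] have the same integral, and [p' - p^2 >= 4]:
   this is a Poincare inequality on [0, 1/2] obtained without Cauchy-Schwarz. *)
Lemma energy_dissipation (m : nat) (d : R) : 12 <= d -> 2 * INR m + 1 <= d ->
  RInt (fun x => 2 * lifted m d x * lifted_d m d x) 0 (1/2)
  <= bdry m d ^ 2 - energy m d.
Proof.
  intros Hd1 Hd2. assert (Hd : 0 < d) by lra.
  assert (HB := bdry_gt0 m d). assert (Hm := pos_INR m).
  set (b := bdry m d) in *.
  set (wx := fun x => mom m 0 d x - mom m 2 d x / d - 2 * b).
  set (wxx := fun x => mom m 3 d x / d ^ 2 - 3 * mom m 1 d x / d).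
  set (Psi := fun x => lifted m d x * wx x + (8 * x - 2) * lifted m d x ^ 2).
  set (dPsi := fun x => wx x ^ 2 + lifted m d x * wxx x + 8 * lifted m d x ^ 2
                        + 2 * (8 * x - 2) * lifted m d x * wx x).
  assert (Dw : forall x, is_derive (lifted m d) x (wx x)).
  { intros x; unfold lifted, wx. apply (is_derive_minus (V := R_NormedModule)).
    - replace (mom m 0 d x - mom m 2 d x / d)
        with (INR 1 * mom m 0 d x - mom m 2 d x / d) by (simpl; ring).
      now apply (is_derive_mom_x m 1).
    - fold b; auto_derive; trivial; ring. }
  assert (Dwx : forall x, is_derive wx x (wxx x)).
  { intros x; unfold wx.
    replace (wxx x) with
      ((INR 0 * mom m 0 d x - mom m 1 d x / d)
        - (INR 2 * mom m 1 d x - mom m 3 d x / d) * / d - 0)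
      by (unfold wxx; simpl; field; lra).
    apply (is_derive_minus (V := R_NormedModule)); [|apply (is_derive_const (V := R_NormedModule))].
    apply (is_derive_minus (V := R_NormedModule)); [now apply (is_derive_mom_x m 0)|].
    apply (is_derive_scal_l (fun x => mom m 2 d x) x _ (/ d)).
    now apply (is_derive_mom_x m 2). }
  assert (DPsi : forall x, is_derive Psi x (dPsi x)).
  { intros x; unfold Psi.
    replace (dPsi x) with ((wx x * wx x + lifted m d x * wxx x)
       + (8 * lifted m d x ^ 2 + (8 * x - 2) * (INR 2 * wx x * lifted m d x ^ pred 2)))
      by (unfold dPsi; simpl; ring).
    apply (is_derive_plus (V := R_NormedModule)).
    - apply (is_derive_mult (K := R_AbsRing) (lifted m d) wx); auto using Rmult_comm.
    - apply (is_derive_mult (K := R_AbsRing) (fun x => 8 * x - 2) (fun x => lifted m d x ^ 2));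
        [auto_derive; trivial; ring|now apply is_derive_pow|exact Rmult_comm]. }
  assert (Cw := fun x => continuous_lifted m d x Hd).
  assert (Cwx : forall x, continuous wx x).
  { intros x; apply (ex_derive_continuous (V := R_NormedModule)); eexists; apply Dwx. }
  assert (CdPsi : forall x, continuous dPsi x).
  { intros x; unfold dPsi, wxx; cont; auto. }
  assert (E := RInt_deriv Psi dPsi 0 (1/2) DPsi CdPsi).
  assert (Z : Psi (1/2) - Psi 0 = 0).
  { unfold Psi. replace (lifted m d (1/2)) with 0. replace (lifted m d 0) with 0. ring.
    - unfold lifted; rewrite mom_1_0; ring.
    - unfold lifted; rewrite mom_1_half; field. }
  assert (Cwd := fun x => continuous_lifted_d m d x Hd).
  assert (L : RInt (fun x => 2 * lifted m d x * lifted_d m d x + lifted m d x ^ 2 + - 2 * b ^ 2) 0 (1/2)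
     <= RInt dPsi 0 (1/2)).
  { apply RInt_le_cont; [lra|cont; auto|exact CdPsi|].
    intros x Hx.
    (* The derivative of b in d is at most b/8, because q <= d gives (q/2)^2/(2 d^2) <= 1/8. *)
    assert (Hb : 0 <= 4 * (b * (INR m + 1/2) ^ 2 / (2 * d ^ 2)) <= b / 2).
    { split; [apply Rmult_le_pos; [lra|]; apply Rdiv_le_0_compat; nra|].
      replace (4 * (b * (INR m + 1 / 2) ^ 2 / (2 * d ^ 2)))
        with (b * ((2 * INR m + 1) ^ 2 / d ^ 2) / 2) by (field; lra).
      apply Rmult_le_compat_r; [lra|]. rewrite <- (Rmult_1_r b) at 2.
      apply Rmult_le_compat_l; [lra|].
      apply (proj2 (Rle_div_l _ _ _ (pow_lt d 2 Hd))); nra. }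
    set (b' := b * (INR m + 1/2) ^ 2 / (2 * d ^ 2)) in *.
    assert (Hi : 0 < / d <= /12) by (split; [apply Rinv_0_lt_compat|apply Rinv_le_contravar]; lra).
    (* The heat equation in the form w'' = 2 w_d - 3M/d + 4 x b', with M = w + 2 x b, is substituted
       after completing the square. Since d >= 12, the term 3 w^2/d costs at most w^2/4 of the
       available 4 w^2. *)
    assert (F : dPsi x = 2 * lifted m d x * lifted_d m d x
       + (wx x + (8 * x - 2) * lifted m d x) ^ 2 + (8 - (8 * x - 2) ^ 2) * lifted m d x ^ 2
       - 3 * / d * lifted m d x * (lifted m d x + 2 * x * b) + 4 * x * lifted m d x * b').
    { unfold dPsi, wxx, lifted_d; fold b; fold b'.
      replace (mom m 1 d x) with (lifted m d x + 2 * x * b) by (unfold lifted; fold b; ring).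
      generalize (lifted m d x) (wx x); intros; field; lra. }
    rewrite F. generalize (lifted m d x) (wx x) (lifted_d m d x); intros w y z.
    assert (S1 : 0 <= (y + (8 * x - 2) * w) ^ 2) by apply pow2_ge_0.
    assert (S2 : 0 <= (4 - (8 * x - 2) ^ 2) * w ^ 2) by (apply Rmult_le_pos; [nra|apply pow2_ge_0]).
    assert (S3 : 0 <= (/4 - 3 * / d) * w ^ 2) by (apply Rmult_le_pos; [lra|apply pow2_ge_0]).
    assert (S4 : Rabs (x * w * (4 * b' - 6 * / d * b)) <= 1/2 * Rabs w * (b / 2)).
    { rewrite !Rabs_mult. rewrite (Rabs_pos_eq x) by lra.
      apply Rmult_le_compat; [apply Rmult_le_pos; [lra|apply Rabs_pos]|apply Rabs_pos| |].
      - apply Rmult_le_compat_r; [apply Rabs_pos|lra].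
      - apply Rabs_le; nra. }
    assert (S5 := Rle_abs (- (x * w * (4 * b' - 6 * / d * b)))); rewrite Rabs_Ropp in S5.
    assert (S6 : 1/2 * Rabs w * (b / 2) <= w ^ 2 + b ^ 2)
      by (rewrite <- (pow2_abs w); assert (Hw := Rabs_pos w); nra).
    assert (S7 : 0 <= w ^ 2) by apply pow2_ge_0.
    assert (S8 : 0 <= b ^ 2) by apply pow2_ge_0.
    lra. }
  rewrite E, Z, !RInt_plus_cont, RInt_cst in L by (cont; auto).
  fold (energy m d) in L. lra.
Qed.

(** Gronwall with integrating factor exp(u): as b increases with u, the dissipation bound gives (E -
    b^2)' <= -(E - b^2) for the energy E. The initial term in b^2 has a favourable sign and is
    dropped. *)
Lemma energy_decay (m : nat) (d1 d : R) : 12 <= d1 -> 2 * INR m + 1 <= d1 <= d ->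
  energy m d <= bdry m d ^ 2 + exp (d1 - d) * energy m d1.
Proof.
  intros H1 [H2 H3].
  set (Z := fun u => exp u * (energy m u - bdry m u ^ 2)).
  set (dE := fun u => RInt (fun x => 2 * lifted m u x * lifted_d m u x) 0 (1/2)).
  set (dB := fun u => bdry m u * (INR m + 1/2) ^ 2 / (2 * u ^ 2)).
  assert (L : Z d <= Z d1).
  { apply (nonincreasing_of_derive Z (fun u =>
      exp u * (energy m u - bdry m u ^ 2) + exp u * (dE u - INR 2 * dB u * bdry m u ^ pred 2)));
      [exact H3| |].
    - intros u Hu. unfold Z.
      apply (is_derive_mult (K := R_AbsRing) exp (fun u => energy m u - bdry m u ^ 2));
        [apply is_derive_exp| |exact Rmult_comm].
      apply (is_derive_minus (V := R_NormedModule)); [apply is_derive_energy; lra|].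
      apply is_derive_pow, is_derive_bdry; lra.
    - intros u Hu. rewrite <- Rmult_plus_distr_l.
      assert (He := exp_pos u).
      assert (D := energy_dissipation m u). fold (dE u) in D.
      assert (P : 0 <= INR 2 * dB u * bdry m u ^ pred 2).
      { assert (Hb := bdry_gt0 m u). unfold dB. simpl INR; simpl pred. rewrite pow_1.
        apply Rmult_le_pos; [|lra]. apply Rmult_le_pos; [lra|].
        apply Rdiv_le_0_compat; [|nra].
        apply Rmult_le_pos; [lra|apply pow2_ge_0]. }
      assert (dE u <= bdry m u ^ 2 - energy m u) by (apply D; lra).
      nra. }
  unfold Z in L. assert (He := exp_pos d). assert (He1 := exp_pos d1).
  unfold Rminus at 1; rewrite exp_plus, exp_Ropp.
  apply (Rmult_le_reg_l (exp d)); [exact He|].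
  rewrite Rmult_plus_distr_l.
  replace (exp d * (exp d1 * / exp d * energy m d1)) with (exp d1 * energy m d1) by (field; lra).
  assert (0 <= bdry m d1 ^ 2) by apply pow2_ge_0. nra.
Qed.

(** Cubing exp(y/3) >= y/3. A cubic is enough, since it only has to beat quadratic factors. *)
Lemma cube_le_exp (y : R) : 0 <= y -> y ^ 3 / 27 <= exp y.
Proof.
  intros Hy. replace (exp y) with (exp (y / 3) ^ 3).
  - replace (y ^ 3 / 27) with ((y / 3) ^ 3) by field.
    apply pow_incr; split; [lra|]. assert (H := exp_ineq1_le (y / 3)); lra.
  - simpl. rewrite Rmult_1_r, <- !exp_plus. f_equal; field.
Qed.

Lemma exp_mono (x y : R) : x <= y -> exp x <= exp y.
Proof. intros [H|H]; [left; now apply exp_increasing|right; now rewrite H]. Qed.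

Lemma exp_le_1 (y : R) : y <= 0 -> exp y <= 1.
Proof. intros H; rewrite <- exp_0; now apply exp_mono. Qed.

Lemma gauss_bounds (m : nat) (d y : R) : 0 < d -> Rabs y <= INR m + 1/2 ->
  exp (- ((INR m + 1/2) ^ 2 / (2 * d))) <= exp (- (y ^ 2 / (2 * d))) <= 1.
Proof.
  intros Hd Hy. assert (H1 := Rabs_pos y).
  assert (H2 : Rabs y ^ 2 <= (INR m + 1/2) ^ 2) by now apply pow_incr.
  rewrite pow2_abs in H2. split.
  - apply exp_mono, Ropp_le_contravar, Rmult_le_compat_r; [|exact H2].
    left; apply Rinv_0_lt_compat; lra.
  - apply exp_le_1. assert (0 <= y ^ 2 / (2 * d)); [|lra].
    apply Rdiv_le_0_compat; [apply pow2_ge_0|lra].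
Qed.

(** Each of the q terms is at least exp(-q^2/(8d)), and q times this value is 2b. *)
Lemma mom_0_bounds (m : nat) (d x : R) : 0 < d -> 0 <= x <= 1/2 ->
  2 * bdry m d <= mom m 0 d x <= 2 * INR m + 1.
Proof.
  intros Hd Hx. unfold bdry, mom.
  destruct (psum_bounds (fun y => y ^ 0 * exp (- (y ^ 2 / (2 * d)))) m
     (exp (- ((INR m + 1/2) ^ 2 / (2 * d)))) 1 x) as [H1 H2]; [lra| |lra].
  intros y Hy. rewrite pow_O, Rmult_1_l. now apply gauss_bounds.
Qed.

Lemma mom_1_bound (m : nat) (d x : R) : 0 < d -> 0 <= x <= 1/2 ->
  Rabs (mom m 1 d x) <= 2 * (INR m + 1/2) ^ 2.
Proof.
  intros Hd Hx. apply Rabs_le.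
  destruct (psum_bounds (fun y => y ^ 1 * exp (- (y ^ 2 / (2 * d)))) m
     (- (INR m + 1/2)) (INR m + 1/2) x) as [H1 H2]; [lra| |unfold mom; nra].
  intros y Hy. rewrite pow_1. apply Rabs_le_between.
  rewrite Rabs_mult, (Rabs_pos_eq (exp _)) by (left; apply exp_pos).
  assert (H1 := Rabs_pos y). destruct (gauss_bounds m d y Hd Hy) as [_ H2].
  assert (H3 := exp_pos (- (y ^ 2 / (2 * d)))). nra.
Qed.

(** Moving 1/2 + j to x + j raises the square by at most m <= 2d, hence costs each term at most a
    factor exp(1) <= 3. *)
Lemma mom_0_ge_third (m : nat) (d x : R) : 0 < d -> 2 * INR m + 1 <= 4 * d ->
  0 <= x <= 1/2 -> mom m 0 d (1/2) / 3 <= mom m 0 d x.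
Proof.
  intros Hd Hm Hx. unfold mom.
  assert (T : forall j, Rabs j <= INR m -> exp (- ((1/2 + j) ^ 2 / (2 * d))) / 3
                                          <= exp (- ((x + j) ^ 2 / (2 * d)))).
  { intros j Hj%Rabs_le_between.
    apply Rle_trans with (exp (- ((1/2 + j) ^ 2 / (2 * d))) * exp (- (1))).
    - apply Rmult_le_compat_l; [left; apply exp_pos|].
      rewrite exp_Ropp. apply Rinv_le_contravar; [apply exp_pos|apply exp_le_3].
    - rewrite <- exp_plus. apply exp_mono.
      apply (Rmult_le_reg_r (2 * d)); [lra|].
      replace ((- ((1/2 + j) ^ 2 / (2 * d)) + - (1)) * (2 * d))
        with (- (1/2 + j) ^ 2 - 2 * d) by (field; lra).
      replace (- ((x + j) ^ 2 / (2 * d)) * (2 * d)) with (- (x + j) ^ 2) by (field; lra).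
      nra. }
  clear Hm; induction m as [|m IH]; cbn [psum]; rewrite !pow_O, !Rmult_1_l.
  - specialize (T 0). rewrite !Rplus_0_r in T. apply T. rewrite Rabs_R0; simpl; lra.
  - assert (Hm := pos_INR m). rewrite S_INR in *.
    assert (T1 := T (INR m + 1)). assert (T2 := T (- (INR m + 1))).
    rewrite Rabs_Ropp in T2. rewrite Rabs_pos_eq in T1, T2 by lra.
    unfold Rminus.
    specialize (T1 (Rle_refl _)); specialize (T2 (Rle_refl _)).
    assert (I : psum (fun y => y ^ 0 * exp (- (y ^ 2 / (2 * d)))) m (1/2) / 3
              <= psum (fun y => y ^ 0 * exp (- (y ^ 2 / (2 * d)))) m x).
    { apply IH; intros j Hj; apply T; lra. }
    lra.
Qed.

(** Any polynomial bound would do: it serves as the initial value at d = q, and is then multiplied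
    by exp(q - d). *)
Lemma energy_bound (m : nat) (d : R) : 0 < d -> (1 <= m)%nat ->
  energy m d <= 5 * (INR m + 1/2) ^ 4.
Proof.
  intros Hd Hm. apply (le_INR 1) in Hm; simpl in Hm.
  set (r := INR m + 1/2).
  replace (5 * r ^ 4) with ((1/2 - 0) * (10 * r ^ 4)) by field.
  rewrite <- RInt_cst. apply RInt_le_cont; [lra| |cont|].
  - intros x; apply continuous_Rpow, continuous_lifted, Hd.
  - intros x Hx. rewrite <- pow2_abs.
    replace (10 * r ^ 4) with (10 * (r ^ 2) ^ 2) by ring.
    assert (Hb : 0 < bdry m d <= r).
    { split; [apply bdry_gt0|]. unfold bdry; fold r.
      assert (exp (- (r ^ 2 / (2 * d))) <= 1).
      { apply exp_le_1. assert (0 <= r ^ 2 / (2 * d)); [|lra].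
        apply Rdiv_le_0_compat; [apply pow2_ge_0|lra]. }
      assert (0 < r) by (unfold r; lra). nra. }
    assert (H1 := mom_1_bound m d x Hd). fold r in H1.
    assert (H2 : Rabs (lifted m d x) <= 3 * r ^ 2).
    { unfold lifted. eapply Rle_trans; [apply Rabs_triang|].
      rewrite Rabs_Ropp, (Rabs_pos_eq (2 * x * _)) by nra.
      assert (1 <= r) by (unfold r; lra).
      assert (Rabs (mom m 1 d x) <= 2 * r ^ 2) by (apply H1; lra). nra. }
    assert (H3 := Rabs_pos (lifted m d x)).
    assert (H4 : Rabs (lifted m d x) ^ 2 <= (3 * r ^ 2) ^ 2) by now apply pow_incr.
    assert (0 <= (r ^ 2) ^ 2) by apply pow2_ge_0. lra.
Qed.

(** Put r = q/2. Multiplied by S(1/2)^2, the equation gives d b S(1/2) <= 18 E + 3 b^2. As S(1/2) >=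
    2b and d is large, the left side dominates every b^2 on the right, leaving only the decaying
    part of E: b^2 <= 5 r^4 exp(q - d). But b^2 = r^2 exp(-r^2/d) is far larger when d >= 2q. *)
Lemma is_d0_lt (m : nat) (d : R) : (200 <= m)%nat -> is_d0 (2 * m + 1) d ->
  d < 2 * (2 * INR m + 1).
Proof.
  intros Hm0 H0. assert (Hm := le_INR _ _ Hm0); simpl in Hm.
  destruct (Rlt_or_le d (2 * (2 * INR m + 1))) as [|HdL]; [assumption|exfalso].
  assert (Hd := proj1 H0).
  assert (Heq := is_d0_cmean m d ltac:(lia) H0). clear H0.
  assert (HB := bdry_gt0 m d). assert (HS := mom_0_gt0 m d (1/2)).
  destruct (mom_0_bounds m d (1/2)) as [HSB _]; [lra..|].
  set (b := bdry m d) in *. set (S2 := mom m 0 d (1/2)) in *.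
  (* M = w + 2 x b and S >= S(1/2)/3 give h^2 <= 9 (2 w^2 + 8 x^2 b^2)/S(1/2)^2. *)
  assert (L1 : RInt (fun x => cmean m d x ^ 2) 0 (1/2)
     <= RInt (fun x => 18 / S2 ^ 2 * lifted m d x ^ 2 + 72 * b ^ 2 / S2 ^ 2 * x ^ 2) 0 (1/2)).
  { apply RInt_le_cont; [lra|cont| |].
    - intros x; cont; now apply continuous_lifted.
    - intros x Hx. assert (HSx := mom_0_ge_third m d x Hd ltac:(lra) ltac:(lra)).
      fold S2 in HSx. unfold cmean.
      assert (HSx2 : (S2 / 3) ^ 2 <= mom m 0 d x ^ 2) by (apply pow_incr; lra).
      unfold Rdiv; rewrite Rpow_mult_distr, pow_inv.
      apply Rle_trans with (mom m 1 d x ^ 2 * / (S2 / 3) ^ 2).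
      + apply Rmult_le_compat_l; [apply pow2_ge_0|].
        apply Rinv_le_contravar; [apply pow_lt; lra|exact HSx2].
      + replace (mom m 1 d x) with (lifted m d x + 2 * x * b) by (unfold lifted; fold b; ring).
        apply (Rmult_le_reg_r (S2 ^ 2)); [apply pow_lt; lra|].
        replace ((lifted m d x + 2 * x * b) ^ 2 * / (S2 / 3) ^ 2 * S2 ^ 2)
          with (9 * (lifted m d x + 2 * x * b) ^ 2) by (field; lra).
        replace ((18 * / S2 ^ 2 * lifted m d x ^ 2 + 72 * b ^ 2 * / S2 ^ 2 * x ^ 2) * S2 ^ 2)
          with (18 * lifted m d x ^ 2 + 72 * b ^ 2 * x ^ 2) by (field; lra).
        assert (0 <= (lifted m d x - 2 * x * b) ^ 2) by apply pow2_ge_0. nra. }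
  rewrite RInt_plus_cont in L1 by (cont; now apply continuous_lifted).
  rewrite !RInt_scal_cont in L1 by (cont; now apply continuous_lifted).
  rewrite RInt_sqr_half in L1.
  fold (energy m d) in L1. rewrite <- Heq in L1.
  apply (Rmult_le_compat_r (S2 ^ 2)) in L1; [|apply pow2_ge_0].
  replace (d * (b / S2) * S2 ^ 2) with (d * b * S2) in L1 by (field; lra).
  match type of L1 with _ <= ?t => replace t with (18 * energy m d + 3 * b ^ 2) in L1
    by (field; lra) end.
  assert (L2 := energy_decay m (2 * INR m + 1) d ltac:(lra) ltac:(lra)). fold b in L2.
  assert (L3 := energy_bound m (2 * INR m + 1) ltac:(lra) ltac:(lia)).
  set (r := INR m + 1/2) in *. replace (2 * INR m + 1) with (2 * r) in * by (unfold r; field).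
  set (e := exp (2 * r - d)) in *.
  assert (He : 0 < e) by apply exp_pos.
  assert (L4 : b ^ 2 <= e * (5 * r ^ 4)).
  { assert (e * energy m (2 * r) <= e * (5 * r ^ 4)) by (apply Rmult_le_compat_l; lra).
    assert (0 <= b ^ 2) by apply pow2_ge_0.
    assert (d * b * (2 * b) <= d * b * S2) by (apply Rmult_le_compat_l; nra).
    assert (100 * b ^ 2 <= d * b ^ 2) by (apply Rmult_le_compat_r; unfold r in *; lra).
    nra. }
  assert (Hr : 200 <= r) by (unfold r; lra).
  unfold b, bdry in L4; fold r in L4.
  replace ((r * exp (- (r ^ 2 / (2 * d)))) ^ 2) with (r ^ 2 * exp (- (r ^ 2 / d))) in L4.
  2:{ rewrite Rpow_mult_distr; f_equal. rewrite <- (Rsqr_pow2 (exp _)); unfold Rsqr; rewrite <- exp_plus.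
      f_equal; field; lra. }
  assert (L5 : exp (- (r ^ 2 / d)) <= e * (5 * r ^ 2)).
  { apply (Rmult_le_reg_l (r ^ 2)); [apply pow_lt; lra|].
    replace (r ^ 2 * (e * (5 * r ^ 2))) with (e * (5 * r ^ 4)) by ring. exact L4. }
  (* Since d >= 4r, r^2/d <= r/4 <= d - 3r, so exp(3r - d) is at most exp(-r^2/d). The cubic bound
     then contradicts this for r > 135. *)
  assert (L6 : exp r <= 5 * r ^ 2).
  { apply (Rmult_le_reg_l e); [exact He|]. unfold e at 1. rewrite <- exp_plus.
    eapply Rle_trans; [|exact L5]. apply exp_mono.
    assert (r ^ 2 / d <= r / 4); [|lra].
    apply (proj2 (Rle_div_l _ _ _ Hd)). nra. }
  assert (L7 := cube_le_exp r ltac:(lra)).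
  assert (0 < r ^ 2) by (apply pow_lt; lra). nra.
Qed.

(** * Lower bound on d *)

(** sin(2 pi x) is the first Dirichlet eigenfunction on [0, 1/2]; testing M against it turns the
    heat equation into a scalar linear equation in [d], with rate 2 pi^2 and a source from the
    boundary value b. *)
Definition sine_coef (m : nat) (d : R) : R :=
  RInt (fun x => mom m 1 d x * sin (2 * PI * x)) 0 (1/2).

Lemma continuous_sin_lin (c x : R) : continuous (fun x => sin (c * x)) x.
Proof.
  apply (ex_derive_continuous (V := R_NormedModule)); auto_derive; trivial.
Qed.

Lemma is_derive_sine_coef (m : nat) (d : R) : 0 < d ->
  is_derive (sine_coef m) d (PI * bdry m d + (3 / (2 * d) - 2 * PI ^ 2) * sine_coef m d).
Proof.
  intros Hd.
  assert (E : RInt (fun x => mom m 3 d x / (2 * d ^ 2) * sin (2 * PI * x)) 0 (1/2)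
     = PI * bdry m d + (3 / (2 * d) - 2 * PI ^ 2) * sine_coef m d :> R).
  { set (Mx := fun x => mom m 0 d x - mom m 2 d x / d).
    set (Mxx := fun x => mom m 3 d x / d ^ 2 - 3 * mom m 1 d x / d).
    (* The boundary term of Green's identity. It vanishes at 0 because M(0) = 0, and equals pi b at
       1/2 because cos(pi) = -1. *)
    set (Psi := fun x => /2 * (Mx x * sin (2 * PI * x)) - PI * (mom m 1 d x * cos (2 * PI * x))).
    set (dPsi := fun x => /2 * Mxx x * sin (2 * PI * x)
                          + 2 * PI ^ 2 * (mom m 1 d x * sin (2 * PI * x))).
    assert (DM : forall x, is_derive (mom m 1 d) x (Mx x)).
    { intros x; unfold Mx.
      replace (mom m 0 d x - mom m 2 d x / d)
        with (INR 1 * mom m 0 d x - mom m 2 d x / d) by (simpl; ring).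
      now apply (is_derive_mom_x m 1). }
    assert (DMx : forall x, is_derive Mx x (Mxx x)).
    { intros x; unfold Mx.
      replace (Mxx x) with
        ((INR 0 * mom m 0 d x - mom m 1 d x / d)
          - (INR 2 * mom m 1 d x - mom m 3 d x / d) * / d)
        by (unfold Mxx; simpl; field; lra).
      apply (is_derive_minus (V := R_NormedModule)); [now apply (is_derive_mom_x m 0)|].
      apply (is_derive_scal_l (fun x => mom m 2 d x) x _ (/ d)).
      now apply (is_derive_mom_x m 2). }
    assert (DPsi : forall x, is_derive Psi x (dPsi x)).
    { intros x; unfold Psi.
      replace (dPsi x) with
        (/2 * (Mxx x * sin (2 * PI * x) + Mx x * (2 * PI * cos (2 * PI * x)))
         - PI * (Mx x * cos (2 * PI * x) + mom m 1 d x * (- (2 * PI) * sin (2 * PI * x))))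
        by (unfold dPsi; field).
      apply (is_derive_minus (V := R_NormedModule)); apply is_derive_scal.
      - apply (is_derive_mult (K := R_AbsRing) Mx (fun x => sin (2 * PI * x)));
          [apply DMx| |exact Rmult_comm]. auto_derive; trivial; ring.
      - apply (is_derive_mult (K := R_AbsRing) (mom m 1 d) (fun x => cos (2 * PI * x)));
          [apply DM| |exact Rmult_comm]. auto_derive; trivial; ring. }
    assert (Cs := continuous_sin_lin (2 * PI)).
    rewrite (RInt_ext_le _ (fun x => dPsi x
               + (3 / (2 * d) - 2 * PI ^ 2) * (mom m 1 d x * sin (2 * PI * x)))).
    - rewrite RInt_plus_cont, RInt_scal_cont by (unfold dPsi, Mxx; cont; apply Cs).
      fold (sine_coef m d). rewrite (RInt_deriv Psi dPsi 0 (1/2) DPsi)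
        by (unfold dPsi, Mxx; cont; apply Cs).
      f_equal. unfold Psi. rewrite mom_1_0, mom_1_half.
      replace (2 * PI * (1/2)) with PI by field. rewrite cos_PI, sin_PI, !Rmult_0_r, sin_0.
      ring.
    - lra.
    - intros x _; unfold dPsi, Mxx. field; lra. }
  rewrite <- E; unfold sine_coef.
  apply (is_derive_RInt_param' (fun d x => mom m 1 d x * sin (2 * PI * x))
           (fun d x => mom m 3 d x / (2 * d ^ 2) * sin (2 * PI * x))).
  - apply locally_gt0; [exact Hd|]; intros y Hy t.
    apply (is_derive_scal_l (fun u => mom m 1 u t) y _ (sin (2 * PI * t))).
    now apply is_derive_mom_d.
  - intros t; unfold Rdiv.
    apply continuity_2d_pt_mult; [apply continuity_2d_pt_mult|].
    + now apply continuity_2d_pt_mom.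
    + apply (continuity_2d_pt_fst (fun u => / (2 * u ^ 2))).
      apply continuous_inv; [cont|nra].
    + apply (continuity_1d_2d_pt_comp (fun v => sin (2 * PI * v)) (fun _ v => v)).
      * apply continuity_pt_filterlim, continuous_sin_lin.
      * apply continuity_2d_pt_id2.
  - apply locally_gt0; [exact Hd|]; intros y Hy t; cont; apply continuous_sin_lin.
Qed.

(** The weight exp(2 pi^2 d) d^(-3/2) is the integrating factor of the homogeneous equation, and the
    source pi b is positive. *)
Lemma sine_coef_growth (m : nat) (d1 d : R) : 0 < d1 <= d ->
  sine_coef m d1 * exp (2 * PI ^ 2 * d1 - 3/2 * ln d1)
  <= sine_coef m d * exp (2 * PI ^ 2 * d - 3/2 * ln d).
Proof.
  intros Hd.
  set (K := fun u => - (sine_coef m u * exp (2 * PI ^ 2 * u - 3/2 * ln u))).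
  enough (L : K d <= K d1) by (unfold K in L; lra).
  apply (nonincreasing_of_derive K (fun u => - (exp (2 * PI ^ 2 * u - 3/2 * ln u)
     * (PI * bdry m u)))); [apply Hd| |].
  - intros u Hu; unfold K. apply (is_derive_opp (V := R_NormedModule)).
    replace (exp (2 * PI ^ 2 * u - 3/2 * ln u) * (PI * bdry m u))
      with ((PI * bdry m u + (3 / (2 * u) - 2 * PI ^ 2) * sine_coef m u)
              * exp (2 * PI ^ 2 * u - 3/2 * ln u)
            + sine_coef m u * ((2 * PI ^ 2 - 3 / (2 * u)) * exp (2 * PI ^ 2 * u - 3/2 * ln u)))
      by ring.
    apply (is_derive_mult (K := R_AbsRing) (sine_coef m)
             (fun u => exp (2 * PI ^ 2 * u - 3/2 * ln u))); [| |exact Rmult_comm].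
    + apply is_derive_sine_coef; lra.
    + auto_derive; [lra|]. unfold Rminus, Rdiv; cbn [pow]; field; lra.
  - intros u _. assert (H1 := exp_pos (2 * PI ^ 2 * u - 3/2 * ln u)).
    assert (H2 := bdry_gt0 m u). assert (H3 := PI_RGT_0).
    assert (0 < exp (2 * PI ^ 2 * u - 3/2 * ln u) * (PI * bdry m u)); [|lra].
    apply Rmult_lt_0_compat; [|apply Rmult_lt_0_compat]; assumption.
Qed.

(** Written with [y ^ 1] so that [mom m 1 d x] is convertible to [psum (ygauss d) m x]. *)
Definition ygauss (d y : R) : R := y ^ 1 * exp (- (y ^ 2 / (2 * d))).

Lemma ygauss_decr (d a b : R) : 0 < d -> sqrt d <= a <= b -> ygauss d b <= ygauss d a.
Proof.
  intros Hd [H1 H2].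
  apply (nonincreasing_of_derive (ygauss d)
           (fun y => (1 - y ^ 2 / d) * exp (- (y ^ 2 / (2 * d))))); [exact H2| |].
  - intros y _; unfold ygauss; auto_derive; trivial.
    unfold Rdiv; cbn [pow]; field; lra.
  - intros y Hy. assert (He := exp_pos (- (y ^ 2 / (2 * d)))).
    assert (Hs := sqrt_pos d). assert (Hq := sqrt_sqrt d ltac:(lra)).
    assert (1 <= y ^ 2 / d); [|nra].
    apply (proj1 (Rle_div_r _ _ _ Hd)). nra.
Qed.

(** Past the two points nearest to 0, each negative term at -(j + 1 - x) is outweighed by the
    positive one at x + j, j >= 1: there sqrt(d) <= 1 <= x + j <= j + 1 - x, where y exp(-y^2/(2d))
    decreases. *)
Lemma mom_1_ge (m : nat) (d x : R) : 0 < d <= 1 -> 0 <= x <= 1/2 ->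
  ygauss d x - ygauss d (1 - x) <= mom m 1 d x.
Proof.
  intros Hd Hx. change (mom m 1 d x) with (psum (ygauss d) m x).
  assert (Hs : sqrt d <= 1) by (rewrite <- sqrt_1; apply sqrt_le_1_alt; lra).
  assert (P : forall y, 0 <= y -> 0 <= ygauss d y).
  { intros y Hy; unfold ygauss. apply Rmult_le_pos; [lra|left; apply exp_pos]. }
  assert (O : forall y, ygauss d (- y) = - ygauss d y).
  { intros y; unfold ygauss; replace ((- y) ^ 2) with (y ^ 2) by ring; ring. }
  destruct m as [|m]; [simpl; assert (H := P (1 - x)); lra|].
  (* The top positive term is kept in reserve to absorb the negative term of the next pair. *)
  enough (L : ygauss d x - ygauss d (1 - x) + ygauss d (x + INR (S m)) <= psum (ygauss d) (S m) x).
  { assert (H := P (x + INR (S m))). assert (Hp := pos_INR (S m)). lra. }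
  induction m as [|m IH].
  - simpl. replace (x - 1) with (- (1 - x)) by ring. rewrite O. lra.
  - change (psum (ygauss d) (S (S m)) x) with (psum (ygauss d) (S m) x
      + (ygauss d (x + INR (S (S m))) + ygauss d (x - INR (S (S m))))).
    replace (x - INR (S (S m))) with (- (INR (S (S m)) - x)) by ring. rewrite O.
    assert (L : ygauss d (INR (S (S m)) - x) <= ygauss d (x + INR (S m))).
    { assert (Hm := pos_INR m). apply ygauss_decr; rewrite ?S_INR; lra. }
    lra.
Qed.

Lemma exp_8_ge : 1000 <= exp 8.
Proof.
  replace (exp 8) with (exp (1/4) ^ 32).
  - assert (H := exp_ineq1_le (1/4)).
    apply Rle_trans with ((5/4) ^ 32); [|apply pow_incr; lra]. nra.
  - rewrite <- Rpower_pow by apply exp_pos. unfold Rpower. rewrite ln_exp.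
    f_equal. simpl; field.
Qed.

(** A starting value independent of [m]. At d = 1/64 the main term peaks at sqrt(d) = 1/8 and the
    negative neighbour is at most exp(-8)/2 <= 1/2000. The interval [1/12, 1/6] around the peak,
    where sin(2 pi x) >= 1/2, outweighs the possible loss elsewhere. *)
Lemma sine_coef_64_ge (m : nat) : 1/2000 <= sine_coef m (/64).
Proof.
  set (F := fun x => mom m 1 (/64) x * sin (2 * PI * x)).
  assert (CF : forall x, continuous F x).
  { assert (0 < /64) by lra. intros x; unfold F; cont; apply continuous_sin_lin. }
  assert (Pi := PI_RGT_0).
  assert (M : forall x, 0 < x < 1/2 -> ygauss (/64) x - /2000 <= mom m 1 (/64) x).
  { intros x Hx. eapply Rle_trans; [|apply mom_1_ge; lra].
    enough (ygauss (/64) (1 - x) <= /2000) by lra.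
    apply Rle_trans with (ygauss (/64) (1/2)).
    - apply ygauss_decr; [lra|]. split; [|lra].
      replace (/64) with (/8 * /8) by field. rewrite sqrt_square; lra.
    - unfold ygauss. replace (- ((1/2) ^ 2 / (2 * / 64))) with (- (8)) by field.
      rewrite exp_Ropp. assert (/ exp 8 <= / 1000) by (apply Rinv_le_contravar; [lra|apply exp_8_ge]).
      lra. }
  assert (S0 : forall x, 0 < x < 1/2 -> 0 <= sin (2 * PI * x) <= 1).
  { intros x Hx; split; [apply sin_ge_0; nra|apply SIN_bound]. }
  assert (G0 : forall x, 0 < x -> 0 < ygauss (/64) x).
  { intros x Hx; unfold ygauss; apply Rmult_lt_0_compat; [lra|apply exp_pos]. }
  assert (F0 : forall x, 0 < x < 1/2 -> - / 2000 <= F x).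
  { intros x Hx. assert (H1 := M x Hx). assert (H2 := S0 x Hx). assert (H3 := G0 x ltac:(lra)).
    unfold F; nra. }
  assert (F1 : forall x, 1/12 < x < 1/6 -> / 72 - / 4000 <= F x).
  { intros x Hx. assert (H1 := M x ltac:(lra)).
    assert (H2 : 1/2 <= sin (2 * PI * x)).
    { rewrite <- sin_PI6. apply sin_incr_1; nra. }
    assert (H3 : / 36 <= ygauss (/64) x).
    { unfold ygauss. replace (/36) with ((1/12) * (/3)) by field. rewrite pow_1.
      apply Rmult_le_compat; [lra|lra|lra|].
      apply Rle_trans with (exp (- (1))).
      - rewrite exp_Ropp. apply Rinv_le_contravar; [apply exp_pos|apply exp_le_3].
      - apply exp_mono. replace (x ^ 2 / (2 * / 64)) with (32 * x ^ 2) by field. nra. }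
    unfold F; nra. }
  assert (Ch := fun a b c => RInt_Chasles F a b c (ex_RInt_cont F a b CF) (ex_RInt_cont F b c CF)).
  unfold sine_coef; fold F. rewrite <- (Ch 0 (1/12) (1/2)), <- (Ch (1/12) (1/6) (1/2)).
  unfold plus; simpl.
  assert (I1 : (1/12 - 0) * (- / 2000) <= RInt F 0 (1/12)).
  { rewrite <- RInt_cst. apply RInt_le_cont; [lra|cont|exact CF|intros; apply F0; lra]. }
  assert (I2 : (1/6 - 1/12) * (/72 - / 4000) <= RInt F (1/12) (1/6)).
  { rewrite <- RInt_cst. apply RInt_le_cont; [lra|cont|exact CF|intros; apply F1; lra]. }
  assert (I3 : (1/2 - 1/6) * (- / 2000) <= RInt F (1/6) (1/2)).
  { rewrite <- RInt_cst. apply RInt_le_cont; [lra|cont|exact CF|intros; apply F0; lra]. }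
  lra.
Qed.

Lemma sine_coef_ge (m : nat) (d : R) : 1/12 <= d ->
  1/2000 * exp (- (17 + 32 * d)) <= sine_coef m d.
Proof.
  intros Hd. assert (G := sine_coef_growth m (/64) d ltac:(lra)).
  assert (J := sine_coef_64_ge m).
  set (e := 2 * PI ^ 2 * d - 3/2 * ln d) in *.
  (* 2 pi^2 <= 32 comes from pi <= 4, and d >= 1/12 gives -ln d <= 1/d - 1 <= 11, so -(3/2) ln d <=
     17. *)
  assert (He : e <= 17 + 32 * d).
  { assert (P1 := PI_4). assert (P0 := PI_RGT_0).
    assert (PI ^ 2 * d <= 16 * d) by (apply Rmult_le_compat_r; nra).
    assert (L : 1 - / d <= ln d).
    { assert (H0 := exp_ineq1_le (/ d - 1)).
      assert (Hi : 0 < / d) by (apply Rinv_0_lt_compat; lra).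
      assert (Hl : ln (/ d) <= / d - 1).
      { rewrite <- (ln_exp (/ d - 1)). apply Rcomplements.ln_le; lra. }
      rewrite ln_Rinv in Hl by lra. lra. }
    assert (/ d <= 12) by (replace 12 with (/ (1/12)) by field; apply Rinv_le_contravar; lra).
    unfold e; lra. }
  assert (E1 : 1 <= exp (2 * PI ^ 2 * / 64 - 3/2 * ln (/64))).
  { rewrite <- exp_0. apply exp_mono. rewrite ln_Rinv by lra.
    assert (0 < ln 64) by (rewrite <- ln_1; apply ln_increasing; lra).
    assert (0 <= PI ^ 2) by apply pow2_ge_0. lra. }
  assert (L : 1/2000 <= sine_coef m d * exp e).
  { eapply Rle_trans; [|exact G]. nra. }
  apply Rle_trans with (1/2000 * exp (- e)).
  - apply Rmult_le_compat_l; [lra|apply exp_mono; lra].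
  - rewrite exp_Ropp. apply (Rmult_le_reg_r (exp e)); [apply exp_pos|].
    rewrite Rmult_assoc, Rinv_l by (assert (H := exp_pos e); lra). lra.
Qed.

(* Integrate [(mom m 1 d x - 2 J sin (2 PI x)) ^ 2 >= 0] with [J := sine_coef m d]. *)
Lemma sine_coef_sqr_le (m : nat) (d : R) : 0 < d ->
  2 * sine_coef m d ^ 2 <= RInt (fun x => mom m 1 d x ^ 2) 0 (1/2).
Proof.
  intros Hd. set (J := sine_coef m d).
  assert (L : RInt (fun x => 4 * J * (mom m 1 d x * sin (2 * PI * x)) + - (4 * J ^ 2)) 0 (1/2)
     <= RInt (fun x => mom m 1 d x ^ 2) 0 (1/2)).
  { apply RInt_le_cont; [lra|cont; apply continuous_sin_lin|cont|].
    intros x _. assert (H := pow2_ge_0 (mom m 1 d x - 2 * J * sin (2 * PI * x))).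
    assert (S := SIN_bound (2 * PI * x)).
    assert (0 <= (1 - sin (2 * PI * x) ^ 2) * J ^ 2)
      by (apply Rmult_le_pos; [nra|apply pow2_ge_0]).
    nra. }
  rewrite RInt_plus_cont, RInt_scal_cont, RInt_cst in L by (cont; apply continuous_sin_lin).
  fold (sine_coef m d) in L. fold J in L. lra.
Qed.

(** The term j = 0 alone suffices: 1/(8d) <= 2 and exp(1) <= 3. *)
Lemma mom_0_half_ge (m : nat) (d : R) : 1/12 <= d -> /9 <= mom m 0 d (1/2).
Proof.
  intros Hd. apply Rle_trans with (exp (- ((1/2) ^ 2 / (2 * d)))).
  - apply Rle_trans with (exp (- (1 + 1))).
    + rewrite exp_Ropp, exp_plus. assert (H := exp_le_3). assert (H0 := exp_pos 1).
      apply Rinv_le_contravar; nra.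
    + apply exp_mono, Ropp_le_contravar. apply (proj2 (Rle_div_l _ _ (2 * d) ltac:(lra))). lra.
  - unfold mom. induction m as [|m IH]; cbn [psum].
    + right; ring.
    + rewrite !pow_O, !Rmult_1_l.
      assert (H1 := exp_pos (- ((1/2 + INR (S m)) ^ 2 / (2 * d)))).
      assert (H2 := exp_pos (- ((1/2 - INR (S m)) ^ 2 / (2 * d)))). lra.
Qed.

(** Put r = q/2 and J = [sine_coef m d]. From S <= q and S(1/2) >= 1/9 the equation gives J^2 <= 18
    r^2 d b. If d <= r/20, then 17 + 32 d <= 2r, so J^2 is at least of order exp(-4r), while b <= r
    exp(-10r). *)
Lemma is_d0_gt (m : nat) (d : R) : 20000 <= INR m -> is_d0 (2 * m + 1) d ->
  (2 * INR m + 1) / 40 < d.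
Proof.
  intros Hm H0.
  assert (Hm1 : (1 <= m)%nat) by (apply INR_le; simpl; lra).
  destruct (Rlt_or_le ((2 * INR m + 1) / 40) d) as [|HdU]; [assumption|exfalso].
  assert (Hd12 := is_d0_ge m d Hm1 H0).
  assert (Hd : 0 < d) by lra.
  assert (Heq := is_d0_cmean m d Hm1 H0). clear H0.
  assert (HJ := sine_coef_ge m d Hd12). assert (HI := sine_coef_sqr_le m d Hd).
  assert (HS := mom_0_half_ge m d Hd12).
  assert (HB := bdry_gt0 m d).
  set (r := INR m + 1/2) in *. replace (2 * INR m + 1) with (2 * r) in * by (unfold r; field).
  assert (Hr : 20000 <= r) by (unfold r; lra).
  assert (L1 : RInt (fun x => / (2 * r) ^ 2 * mom m 1 d x ^ 2) 0 (1/2)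
               <= RInt (fun x => cmean m d x ^ 2) 0 (1/2)).
  { apply RInt_le_cont; [lra|cont|cont|]. intros x Hx.
    assert (H1 := mom_0_gt0 m d x).
    destruct (mom_0_bounds m d x Hd ltac:(lra)) as [_ H2].
    unfold cmean, Rdiv. rewrite (Rpow_mult_distr (mom m 1 d x)), Rmult_comm.
    apply Rmult_le_compat_l; [apply pow2_ge_0|]. rewrite pow_inv.
    apply Rinv_le_contravar; [apply pow_lt; lra|]. apply pow_incr; unfold r; lra. }
  rewrite RInt_scal_cont, <- Heq in L1 by cont.
  assert (L2 : bdry m d / mom m 0 d (1/2) <= 9 * bdry m d).
  { apply (proj2 (Rle_div_l _ _ (mom m 0 d (1/2)) ltac:(lra))). nra. }
  assert (L3 : / (2 * r) ^ 2 * (2 * sine_coef m d ^ 2) <= 9 * d * bdry m d).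
  { eapply Rle_trans; [apply Rmult_le_compat_l; [|exact HI]|].
    - left; apply Rinv_0_lt_compat, pow_lt; lra.
    - eapply Rle_trans; [exact L1|]. nra. }
  assert (L4 : sine_coef m d ^ 2 <= 18 * r ^ 2 * d * bdry m d).
  { apply (Rmult_le_compat_l ((2 * r) ^ 2)) in L3; [|apply pow2_ge_0].
    replace ((2 * r) ^ 2 * (/ (2 * r) ^ 2 * (2 * sine_coef m d ^ 2)))
      with (2 * sine_coef m d ^ 2) in L3 by (field; lra). lra. }
  assert (L5 : (1/2000 * exp (- (17 + 32 * d))) ^ 2 <= sine_coef m d ^ 2).
  { apply pow_incr; split; [|exact HJ].
    apply Rmult_le_pos; [lra|left; apply exp_pos]. }
  assert (L6 : bdry m d <= r * exp (- (10 * r))).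
  { unfold bdry; fold r. apply Rmult_le_compat_l; [lra|]. apply exp_mono, Ropp_le_contravar.
    apply (proj1 (Rle_div_r _ _ (2 * d) ltac:(lra))). nra. }
  assert (L7 : (1/2000 * exp (- (2 * r))) ^ 2 <= (1/2000 * exp (- (17 + 32 * d))) ^ 2).
  { apply pow_incr; split; [apply Rmult_le_pos; [lra|left; apply exp_pos]|].
    apply Rmult_le_compat_l; [lra|]. apply exp_mono; lra. }
  assert (L8 : (1/2000 * exp (- (2 * r))) ^ 2 <= r ^ 4 * exp (- (10 * r))).
  { eapply Rle_trans; [exact L7|]. eapply Rle_trans; [exact L5|].
    eapply Rle_trans; [exact L4|].
    apply Rle_trans with (18 * r ^ 2 * (r / 20) * (r * exp (- (10 * r)))).
    - apply Rmult_le_compat; [| |apply Rmult_le_compat_l; [nra|lra]|exact L6]; [nra|lra].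
    - assert (He := exp_pos (- (10 * r))). assert (0 < r ^ 4) by (apply pow_lt; lra).
      assert (0 < r ^ 4 * exp (- (10 * r))) by now apply Rmult_lt_0_compat.
      lra. }
  replace (exp (- (10 * r))) with (exp (- (2 * r)) ^ 2 * exp (- (3 * r)) ^ 2) in L8.
  2:{ rewrite <- !Rsqr_pow2; unfold Rsqr; rewrite <- !exp_plus; f_equal; ring. }
  assert (L9 : 1 <= (2000 * r ^ 2 * exp (- (3 * r))) ^ 2).
  { assert (0 < exp (- (2 * r)) ^ 2) by apply pow_lt, exp_pos.
    apply (Rmult_le_reg_l (exp (- (2 * r)) ^ 2)); [assumption|]. lra. }
  assert (L10 := cube_le_exp (3 * r) ltac:(lra)).
  rewrite exp_Ropp in L9.
  assert (L11 : 2000 * r ^ 2 * / exp (3 * r) < 1).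
  { apply (Rmult_lt_reg_r (exp (3 * r))); [apply exp_pos|].
    rewrite Rmult_assoc, Rinv_l by (assert (H := exp_pos (3 * r)); lra).
    assert (0 < r ^ 2) by (apply pow_lt; lra). nra. }
  assert (0 <= 2000 * r ^ 2 * / exp (3 * r)).
  { apply Rmult_le_pos; [nra|]. left; apply Rinv_0_lt_compat, exp_pos. }
  nra.
Qed.

(** * The Gaussian integral *)

Definition gauss_int (x : R) : R := RInt (fun t => exp (- t ^ 2)) 0 x.

Lemma continuous_gauss (x : R) : continuous (fun t => exp (- t ^ 2)) x.
Proof. apply (ex_derive_continuous (V := R_NormedModule)); auto_derive; trivial. Qed.

Lemma is_derive_gauss_int (x : R) : is_derive gauss_int x (exp (- x ^ 2)).
Proof.
  apply (is_derive_RInt (fun t => exp (- t ^ 2)) gauss_int 0); [|apply continuous_gauss].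
  apply filter_forall; intros y. apply (RInt_correct (V := R_CompleteNormedModule)).
  apply ex_RInt_cont, continuous_gauss.
Qed.

(* The derivative in [x] of the integral of [exp (- x^2 (1 + t^2)) / (1 + t^2)] over [0, 1]
   is minus that of [gauss_int x ^ 2], and at [x = 0] the integral is [atan 1]. *)
Definition gauss_compl (x : R) : R :=
  RInt (fun t => exp (- (x ^ 2 * (1 + t ^ 2))) / (1 + t ^ 2)) 0 1.

Lemma continuous_gauss_compl (x t : R) :
  continuous (fun t => exp (- (x ^ 2 * (1 + t ^ 2))) / (1 + t ^ 2)) t.
Proof.
  apply (ex_derive_continuous (V := R_NormedModule)); auto_derive. nra.
Qed.

(** Differentiation cancels the denominator 1 + t^2; the substitution u = x t turns what remains
    into [gauss_int x]. *)
Lemma is_derive_gauss_compl (x : R) :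
  is_derive gauss_compl x (- (2 * exp (- x ^ 2) * gauss_int x)).
Proof.
  replace (- (2 * exp (- x ^ 2) * gauss_int x)) with
    (RInt (fun t => -2 * x * exp (- (x ^ 2 * (1 + t ^ 2)))) 0 1).
  - apply (is_derive_RInt_param' (fun x t => exp (- (x ^ 2 * (1 + t ^ 2))) / (1 + t ^ 2))
             (fun x t => -2 * x * exp (- (x ^ 2 * (1 + t ^ 2))))).
    + apply filter_forall; intros y t. auto_derive; [nra|].
      unfold Rdiv; cbn [pow]; field; nra.
    + intros t. apply continuity_2d_pt_mult.
      * apply (continuity_2d_pt_fst (fun x => -2 * x)); cont.
      * apply (continuity_1d_2d_pt_comp exp (fun u v => - (u ^ 2 * (1 + v ^ 2)))).
        { apply derivable_continuous_pt, derivable_pt_exp. }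
        apply continuity_2d_pt_opp, continuity_2d_pt_mult.
        { apply (continuity_2d_pt_fst (fun x => x ^ 2)); cont. }
        apply (continuity_1d_2d_pt_comp (fun v => 1 + v ^ 2) (fun _ v => v)).
        { apply continuity_pt_filterlim. change (continuous (fun v => 1 + v ^ 2) t). cont. }
        apply continuity_2d_pt_id2.
    + apply filter_forall; intros y t; apply continuous_gauss_compl.
  - transitivity (-2 * exp (- x ^ 2) * RInt (fun t => x * exp (- (x * t + 0) ^ 2)) 0 1).
    + rewrite <- RInt_scal_cont.
      * apply RInt_ext_le; [lra|]. intros t _.
        replace (- (x ^ 2 * (1 + t ^ 2))) with (- x ^ 2 + - (x * t + 0) ^ 2) by ring.
        rewrite exp_plus; ring.
      * intros t; apply (ex_derive_continuous (V := R_NormedModule)); auto_derive; trivial.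
    + assert (E := RInt_comp_lin (V := R_CompleteNormedModule) (fun t => exp (- t ^ 2)) x 0 0 1).
      unfold gauss_int. replace (x * 0 + 0) with 0 in E by ring.
      replace (x * 1 + 0) with x in E by ring.
      rewrite <- E; [|apply ex_RInt_cont, continuous_gauss].
      change (-2 * exp (- x ^ 2) * RInt (fun t => x * exp (- (x * t + 0) ^ 2)) 0 1
        = - (2 * exp (- x ^ 2) * RInt (fun t => x * exp (- (x * t + 0) ^ 2)) 0 1)).
      ring.
Qed.

Lemma gauss_int_sqr (x : R) : 0 <= x -> gauss_int x ^ 2 = PI / 4 - gauss_compl x.
Proof.
  intros Hx.
  set (K := fun u => gauss_int u ^ 2 + gauss_compl u).
  assert (D : forall u, is_derive K u 0).
  { intros u; unfold K.
    replace 0 with (INR 2 * exp (- u ^ 2) * gauss_int u ^ pred 2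
                    + - (2 * exp (- u ^ 2) * gauss_int u)) by (simpl; ring).
    apply (is_derive_plus (V := R_NormedModule)); [|apply is_derive_gauss_compl].
    apply is_derive_pow, is_derive_gauss_int. }
  assert (E : K x = K 0).
  { assert (E := RInt_deriv K (fun _ => 0) 0 x D (fun _ => continuous_const _ _)).
    rewrite RInt_cst in E. lra. }
  assert (K0 : K 0 = PI / 4).
  { unfold K, gauss_int, gauss_compl. rewrite RInt_point. unfold zero; simpl.
    rewrite (RInt_ext_le _ (fun t => / (1 + t ^ 2))).
    - rewrite (RInt_deriv atan (fun t => / (1 + t ^ 2))).
      + rewrite atan_1, atan_0. field.
      + intros t. apply is_derive_Reals.
        apply derivable_pt_lim_atan.
      + intros t; apply (ex_derive_continuous (V := R_NormedModule)); auto_derive; nra.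
    - lra.
    - intros t _. replace (- (0 * (0 * 1) * (1 + t * (t * 1)))) with 0 by ring.
      rewrite exp_0. field; nra. }
  unfold K in E at 1. lra.
Qed.

Lemma gauss_int_ge0 (x : R) : 0 <= x -> 0 <= gauss_int x.
Proof.
  intros Hx. replace 0 with ((x - 0) * 0) by ring. rewrite <- RInt_cst.
  apply RInt_le_cont; [exact Hx|cont|apply continuous_gauss|].
  intros; left; apply exp_pos.
Qed.

(** The complement lies between 0 and 1/y^2, so 4 [gauss_int y]^2 lies between pi - 4/y^2 and pi.
    With c = 2/y^2 <= 1, pi (1 - c)^2 <= pi (1 - c) <= pi - 4/y^2 because pi >= 2. *)
Lemma gauss_int_bounds (y : R) : 0 < y ->
  sqrt PI * (1 - 2 / y ^ 2) <= 2 * gauss_int y <= sqrt PI.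
Proof.
  intros Hy.
  assert (E := gauss_int_sqr y ltac:(lra)). assert (P := gauss_int_ge0 y ltac:(lra)).
  assert (B : 0 <= gauss_compl y <= / y ^ 2).
  { unfold gauss_compl; split.
    - replace 0 with ((1 - 0) * 0) at 1 by ring. rewrite <- RInt_cst.
      apply RInt_le_cont; [lra|cont|apply continuous_gauss_compl|].
      intros t _. apply Rdiv_le_0_compat; [left; apply exp_pos|nra].
    - replace (/ y ^ 2) with ((1 - 0) * / y ^ 2) by ring. rewrite <- RInt_cst.
      apply RInt_le_cont; [lra|apply continuous_gauss_compl|cont|].
      intros t _. assert (Hy2 : 0 < y ^ 2) by now apply pow_lt.
      assert (He := exp_ineq1_le (y ^ 2 * (1 + t ^ 2))).
      assert (Ht : 0 <= t ^ 2) by apply pow2_ge_0.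
      apply Rle_trans with (/ y ^ 2 * / 1).
      + apply Rmult_le_compat; [left; apply exp_pos|left; apply Rinv_0_lt_compat; lra| |].
        * rewrite exp_Ropp. apply Rinv_le_contravar; nra.
        * apply Rinv_le_contravar; lra.
      + rewrite Rinv_1; lra. }
  assert (Hpi := PI_RGT_0). assert (Hs := sqrt_sqrt PI ltac:(lra)).
  assert (Hs0 : 0 < sqrt PI) by now apply sqrt_lt_R0.
  assert (P3 : 2 <= PI) by (assert (H := PI2_1); lra).
  split.
  - destruct (Rle_or_lt (1 - 2 / y ^ 2) 0) as [N|N]; [nra|].
    apply Rsqr_incr_0; [|nra|lra].
    assert (Hy2 : 0 < 2 / y ^ 2) by (apply Rdiv_lt_0_compat; [lra|now apply pow_lt]).
    assert (4 * / y ^ 2 <= PI * (2 / y ^ 2)) by (unfold Rdiv in *; nra).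
    unfold Rsqr. nra.
  - apply Rsqr_incr_0; [|lra|lra]. unfold Rsqr. nra.
Qed.

Lemma mom_0_0_integral (m : nat) (d : R) : 0 < d ->
  Rabs (mom m 0 d 0 - 2 * RInt (fun y => exp (- (y ^ 2 / (2 * d)))) 0 (INR m)) <= 1.
Proof.
  intros Hd. set (e := fun y => exp (- (y ^ 2 / (2 * d)))).
  assert (Ce : forall x, continuous e x).
  { intros x; apply (ex_derive_continuous (V := R_NormedModule)); unfold e; auto_derive; lra. }
  assert (De : forall x y, 0 <= x <= y -> e y <= e x).
  { intros x y Hxy; apply exp_mono, Ropp_le_contravar, Rmult_le_compat_r.
    - left; apply Rinv_0_lt_compat; lra.
    - now apply pow_incr. }
  assert (He0 : forall y, 0 < e y) by (intros; apply exp_pos).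
  assert (I : forall j, e (INR (S j)) <= RInt e (INR j) (INR (S j)) <= e (INR j)).
  { intros j; rewrite S_INR; assert (Hj := pos_INR j).
    replace (e (INR j + 1)) with ((INR j + 1 - INR j) * e (INR j + 1)) by ring.
    replace (e (INR j)) with ((INR j + 1 - INR j) * e (INR j)) by ring.
    rewrite <- !RInt_cst.
    split; (apply RInt_le_cont; [lra|cont; apply Ce|cont; apply Ce|intros; apply De; lra]). }
  (* Left and right Riemann sums of a decreasing function. The term [2 * e (INR m)] makes the second
     bound exactly the left sum, so that the induction closes. *)
  assert (U : mom m 0 d 0 <= 1 + 2 * RInt e 0 (INR m) /\
              2 * RInt e 0 (INR m) <= mom m 0 d 0 + 1 - 2 * e (INR m)).
  { induction m as [|m IH].
    - change (INR 0) with 0. rewrite RInt_point. unfold zero, mom, e; simpl.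
      replace (- (0 * (0 * 1) / (2 * d))) with 0 by (field; lra). rewrite exp_0; lra.
    - rewrite <- (RInt_Chasles e 0 (INR m) (INR (S m))) by now apply ex_RInt_cont.
      unfold plus; simpl plus.
      assert (M : mom (S m) 0 d 0 = mom m 0 d 0 + 2 * e (INR (S m))).
      { unfold mom; cbn [psum]. rewrite !pow_O, !Rmult_1_l.
        replace ((0 - INR (S m)) ^ 2) with ((INR (S m)) ^ 2) by ring.
        rewrite Rplus_0_l. fold (e (INR (S m))). ring. }
      specialize (I m). rewrite M. simpl. simpl in I. lra. }
  specialize (He0 (INR m)). apply Rabs_le. lra.
Qed.

Lemma RInt_gauss_scaled (d a : R) : 0 < d ->
  RInt (fun y => exp (- (y ^ 2 / (2 * d)))) 0 a = sqrt (2 * d) * gauss_int (a / sqrt (2 * d)).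
Proof.
  intros Hd. set (s := sqrt (2 * d)).
  assert (Hs : 0 < s) by (apply sqrt_lt_R0; lra).
  assert (Hss : s * s = 2 * d) by (apply sqrt_sqrt; lra).
  assert (E := RInt_comp_lin (V := R_CompleteNormedModule) (fun t => exp (- t ^ 2)) (/ s) 0 0 a).
  replace (/ s * 0 + 0) with 0 in E by ring.
  replace (/ s * a + 0) with (a / s) in E by (unfold Rdiv; ring).
  unfold gauss_int. rewrite <- E by apply ex_RInt_cont, continuous_gauss.
  change (RInt (fun y => exp (- (y ^ 2 / (2 * d)))) 0 a
          = s * RInt (fun y => / s * exp (- (/ s * y + 0) ^ 2)) 0 a).
  rewrite <- RInt_scal_cont.
  - apply RInt_ext; intros y _. rewrite <- Hss.
    replace (- (/ s * y + 0) ^ 2) with (- (y ^ 2 / (s * s))) by (field; lra).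
    change (exp (- (y ^ 2 / (s * s))) = s * (/ s * exp (- (y ^ 2 / (s * s))))).
    field; lra.
  - intros x; apply (ex_derive_continuous (V := R_NormedModule)); auto_derive; trivial.
Qed.

Lemma abs_ln_le (u e : R) : 0 <= e <= 1/2 -> 1 - e <= u <= 1 + e -> Rabs (ln u) <= 2 * e.
Proof.
  intros He Hu. apply Rabs_le.
  assert (H1 := exp_ineq1_le (u - 1)).
  assert (L1 : ln u <= u - 1).
  { rewrite <- (ln_exp (u - 1)). apply Rcomplements.ln_le; lra. }
  assert (H2 := exp_ineq1_le (/ u - 1)).
  assert (Hi : 0 < / u) by (apply Rinv_0_lt_compat; lra).
  assert (L2 : ln (/ u) <= / u - 1).
  { rewrite <- (ln_exp (/ u - 1)). apply Rcomplements.ln_le; lra. }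
  rewrite ln_Rinv in L2 by lra.
  assert (/ u <= 1 + 2 * e).
  { apply (Rmult_le_reg_l u); [lra|]. rewrite Rinv_r by lra. nra. }
  lra.
Qed.

(** * Asymptotics *)

Lemma is_derive_ln_mom_0 (m : nat) (d x : R) : 0 < d ->
  is_derive (fun y => ln (mom m 0 d y)) x (- / d * cmean m d x).
Proof.
  intros Hd. assert (H0 := mom_0_gt0 m d x).
  replace (- / d * cmean m d x)
    with ((INR 0 * mom m 0 d x - mom m 1 d x / d) * / mom m 0 d x)
    by (unfold cmean; simpl; field; lra).
  apply (is_derive_comp ln (mom m 0 d)); [|now apply (is_derive_mom_x m 0)].
  now apply is_derive_Reals, derivable_pt_lim_ln.
Qed.

Lemma continuous_ln_mom_0 (m : nat) (d x : R) : 0 < d ->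
  continuous (fun y => ln (mom m 0 d y)) x.
Proof.
  intros Hd; apply (ex_derive_continuous (V := R_NormedModule)); eexists.
  now apply is_derive_ln_mom_0.
Qed.

(** No pointwise bound on h is required: |h| <= 1 + h^2, and the equation itself evaluates the
    integral of h^2. The oscillation of ln S is thus at most 1/(2d) + b/S(1/2), where d > r/20
    bounds the first term by 10/r and d < 4r makes b exponentially small (r = q/2). *)
Lemma is_d0_ln_mom_0_osc (m : nat) (d x : R) :
  20000 <= INR m -> is_d0 (2 * m + 1) d -> 0 <= x <= 1/2 ->
  Rabs (ln (mom m 0 d x) - ln (mom m 0 d 0)) <= 17 / (INR m + 1/2).
Proof.
  intros Hm H0 Hx.
  assert (Hm1 : (200 <= m)%nat) by (apply INR_le; simpl; lra).
  assert (Hd12 := is_d0_ge m d ltac:(lia) H0).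
  assert (HdU := is_d0_lt m d Hm1 H0). assert (HdL := is_d0_gt m d Hm H0).
  assert (Heq := is_d0_cmean m d ltac:(lia) H0).
  assert (Hd : 0 < d) by lra.
  assert (HS := mom_0_half_ge m d Hd12). assert (HB := bdry_gt0 m d).
  set (r := INR m + 1/2) in *.
  replace (2 * INR m + 1) with (2 * r) in * by (unfold r; field).
  assert (Hr : 20000 <= r) by (unfold r; lra).
  assert (Hi : 0 < / d) by now apply Rinv_0_lt_compat.
  rewrite <- (RInt_deriv (fun y => ln (mom m 0 d y)) (fun y => - / d * cmean m d y) 0 x);
    [|intros; now apply is_derive_ln_mom_0|cont].
  set (k := fun y => / d * (1 + cmean m d y ^ 2)).
  assert (Ck : forall y, continuous k y) by (unfold k; cont).
  assert (k0 : forall y, 0 <= k y).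
  { intros y; unfold k; assert (H := pow2_ge_0 (cmean m d y)); nra. }
  assert (L1 : RInt k 0 x <= RInt k 0 (1/2)).
  { rewrite <- (RInt_Chasles k 0 x (1/2)) by now apply ex_RInt_cont.
    assert (L : (1/2 - x) * 0 <= RInt k x (1/2)).
    { rewrite <- RInt_cst. apply RInt_le_cont; [lra|cont|exact Ck|auto]. }
    unfold plus; simpl plus; simpl in *; lra. }
  assert (L2 : RInt k 0 (1/2) = / (2 * d) + bdry m d / mom m 0 d (1/2) :> R).
  { unfold k. rewrite RInt_scal_cont, RInt_plus_cont, RInt_cst, <- Heq by cont. field; lra. }
  assert (L3 : / (2 * d) <= 10 / r).
  { replace (10 / r) with (/ (r / 10)) by (field; lra). apply Rinv_le_contravar; lra. }
  assert (L4 : bdry m d / mom m 0 d (1/2) <= 9 * bdry m d).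
  { apply (proj2 (Rle_div_l _ _ (mom m 0 d (1/2)) ltac:(lra))). nra. }
  assert (L5 : 9 * bdry m d <= 7 / r).
  { assert (E : exp (- (r ^ 2 / (2 * d))) <= / (r ^ 3 / 13824)).
    { apply Rle_trans with (exp (- (r / 8))).
      - apply exp_mono, Ropp_le_contravar, (proj1 (Rle_div_r _ _ (2 * d) ltac:(lra))). nra.
      - rewrite exp_Ropp. assert (H := cube_le_exp (r / 8) ltac:(lra)).
        assert (0 < r ^ 3) by (apply pow_lt; lra).
        apply Rinv_le_contravar; lra. }
    unfold bdry; fold r. apply (proj1 (Rle_div_r _ _ r ltac:(lra))).
    apply Rle_trans with (9 * (r * / (r ^ 3 / 13824)) * r).
    - apply Rmult_le_compat_r; [lra|]. apply Rmult_le_compat_l; [lra|].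
      apply Rmult_le_compat_l; [lra|exact E].
    (* Here 13824 = 24^3 comes from the cubic bound at r/8. The requirement 124416/r <= 7 holds from
       r = 17774 on, which accounts for the threshold 20000. *)
    - replace (9 * (r * / (r ^ 3 / 13824)) * r) with (124416 / r) by (field; lra).
      apply (proj2 (Rle_div_l _ _ r ltac:(lra))). lra. }
  assert (K : RInt k 0 x <= 17 / r).
  { replace (17 / r) with (10 / r + 7 / r) by (field; lra). lra. }
  assert (U : RInt (fun y => - / d * cmean m d y) 0 x <= RInt k 0 x).
  { apply RInt_le_cont; [lra|cont|exact Ck|]. intros y _; unfold k.
    assert (H := pow2_ge_0 (cmean m d y + 1)).
    assert (- cmean m d y <= 1 + cmean m d y ^ 2) by nra. nra. }
  assert (V : -1 * RInt k 0 x <= RInt (fun y => - / d * cmean m d y) 0 x).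
  { rewrite <- RInt_scal_cont by exact Ck.
    apply RInt_le_cont; [lra|cont; apply Ck|cont|]. intros y _; unfold k.
    assert (H := pow2_ge_0 (cmean m d y - 1)).
    assert (cmean m d y <= 1 + cmean m d y ^ 2) by nra. nra. }
  apply Rabs_le. lra.
Qed.

Lemma is_d0_mom_0_0 (m : nat) (d : R) : 20000 <= INR m -> is_d0 (2 * m + 1) d ->
  Rabs (ln (mom m 0 d 0) - ln (2 * PI * d) / 2) <= 10 / sqrt (INR m + 1/2).
Proof.
  intros Hm H0.
  assert (Hm1 : (200 <= m)%nat) by (apply INR_le; simpl; lra).
  assert (HdU := is_d0_lt m d Hm1 H0). assert (HdL := is_d0_gt m d Hm H0).
  assert (Hd : 0 < d) by apply H0.
  set (r := INR m + 1/2) in *.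
  replace (2 * INR m + 1) with (2 * r) in * by (unfold r; field).
  assert (Hr : 20000 <= r) by (unfold r; lra).
  assert (Hsr : sqrt r * sqrt r = r) by (apply sqrt_sqrt; lra).
  assert (Hsr0 : 100 <= sqrt r).
  { replace 100 with (sqrt (100 * 100)) by (apply sqrt_square; lra).
    apply sqrt_le_1_alt; lra. }
  assert (I := mom_0_0_integral m d Hd). rewrite RInt_gauss_scaled in I by exact Hd.
  set (s := sqrt (2 * d)) in *.
  assert (Hs : 0 < s) by (apply sqrt_lt_R0; lra).
  assert (Hss : s * s = 2 * d) by (apply sqrt_sqrt; lra).
  assert (P3 : 2 <= PI) by (assert (H := PI2_1); lra).
  set (p := sqrt PI).
  assert (Hp : 0 < p) by (apply sqrt_lt_R0; lra).
  assert (Hpp : p * p = PI) by (apply sqrt_sqrt; lra).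
  assert (Hp1 : 1 < p) by nra.
  assert (Hmr : r / 2 <= INR m) by (unfold r; lra).
  assert (Y : 0 < INR m / s) by (apply Rdiv_lt_0_compat; lra).
  (* Cost of cutting the Gaussian integral at m: 2d <= 8r and m >= r/2. *)
  assert (Y2 : 2 / (INR m / s) ^ 2 <= 64 / r).
  { replace (2 / (INR m / s) ^ 2) with (2 * (s * s) / INR m ^ 2) by (field; lra).
    rewrite Hss. apply (proj2 (Rle_div_l _ _ (INR m ^ 2) (pow_lt (INR m) 2 ltac:(lra)))).
    apply Rle_trans with (64 / r * (r / 2) ^ 2).
    - replace (64 / r * (r / 2) ^ 2) with (16 * r) by (field; lra). lra.
    - apply Rmult_le_compat_l; [left; apply Rdiv_lt_0_compat; lra|].
      apply pow_incr; lra. }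
  assert (G := gauss_int_bounds (INR m / s) Y). fold p in G.
  set (v := gauss_int (INR m / s)) in *.
  set (S0 := mom m 0 d 0) in *.
  assert (HS0 : 0 < S0) by apply mom_0_gt0.
  assert (Sp : / (p * s) <= 4 / sqrt r).
  { replace (4 / sqrt r) with (/ (sqrt r / 4)) by (field; lra).
    apply Rinv_le_contravar; [lra|].
    apply Rsqr_incr_0; [|lra|nra]. unfold Rsqr. nra. }
  assert (R1 : 64 / r <= 64 / 100 / sqrt r).
  { rewrite <- Hsr at 1. replace (64 / (sqrt r * sqrt r)) with (64 * / sqrt r * / sqrt r) by (field; lra).
    replace (64 / 100 / sqrt r) with (64 * / sqrt r * / 100) by (field; lra).
    assert (0 < / sqrt r) by (apply Rinv_0_lt_compat; lra).
    apply Rmult_le_compat_l; [lra|]. apply Rinv_le_contravar; lra. }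
  assert (R2 : 0 < / sqrt r <= /100) by (split; [apply Rinv_0_lt_compat|apply Rinv_le_contravar]; lra).
  (* Relative errors add up: 4/sqrt(r) from replacing the sum by an integral, and 64/r <=
     0.64/sqrt(r) from the cut. *)
  assert (Hu : Rabs (ln (S0 / (p * s))) <= 2 * (4.64 / sqrt r)).
  { apply abs_ln_le.
    - unfold Rdiv; lra.
    - assert (E : S0 / (p * s) = 2 * v / p + (S0 - 2 * (s * v)) * / (p * s)) by (field; lra).
      apply Rabs_le_between in I.
      assert (B : - / (p * s) <= (S0 - 2 * (s * v)) * / (p * s) <= / (p * s)).
      { assert (0 < / (p * s)) by (apply Rinv_0_lt_compat; nra). nra. }
      assert (W : 1 - 64 / r <= 2 * v / p <= 1).
      { split.
        - apply (proj1 (Rle_div_r _ _ p Hp)). nra.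
        - apply (proj2 (Rle_div_l _ _ p Hp)). lra. }
      rewrite E. unfold Rdiv in *; lra. }
  assert (Eln : ln S0 - ln (2 * PI * d) / 2 = ln (S0 / (p * s))).
  { assert (Hps : 0 < p * s) by nra.
    unfold Rdiv at 2. rewrite (ln_mult S0), ln_Rinv by (try apply Rinv_0_lt_compat; assumption).
    replace (2 * PI * d) with (p * s * (p * s)) by nra.
    rewrite ln_mult by assumption. field. }
  rewrite Eln. fold r. eapply Rle_trans; [exact Hu|]. unfold Rdiv; lra.
Qed.

Definition mean_ln (m : nat) (d : R) : R := 2 * RInt (fun x => ln (mom m 0 d x)) 0 (1/2).

Lemma is_d0_mean_ln (m : nat) (d : R) : 20000 <= INR m -> is_d0 (2 * m + 1) d ->
  Rabs (mean_ln m d - ln (2 * PI * d) / 2) <= 11 / sqrt (INR m + 1/2).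
Proof.
  intros Hm H0. assert (Hd : 0 < d) by apply H0.
  assert (L0 := is_d0_mom_0_0 m d Hm H0).
  assert (Osc := fun x => is_d0_ln_mom_0_osc m d x Hm H0).
  set (r := INR m + 1/2) in *. set (a := ln (mom m 0 d 0)) in *.
  assert (Hr : 20000 <= r) by (unfold r; lra).
  assert (C := fun x => continuous_ln_mom_0 m d x Hd).
  assert (U : RInt (fun x => ln (mom m 0 d x)) 0 (1/2) <= (1/2 - 0) * (a + 17 / r)).
  { rewrite <- RInt_cst. apply RInt_le_cont; [lra|exact C|cont|].
    intros x Hx; specialize (Osc x ltac:(lra)); apply Rabs_le_between in Osc; lra. }
  assert (V : (1/2 - 0) * (a - 17 / r) <= RInt (fun x => ln (mom m 0 d x)) 0 (1/2)).
  { rewrite <- RInt_cst. apply RInt_le_cont; [lra|cont|exact C|].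
    intros x Hx; specialize (Osc x ltac:(lra)); apply Rabs_le_between in Osc; lra. }
  assert (Hsr : sqrt r * sqrt r = r) by (apply sqrt_sqrt; lra).
  assert (Hsr0 : 100 <= sqrt r).
  { replace 100 with (sqrt (100 * 100)) by (apply sqrt_square; lra).
    apply sqrt_le_1_alt; lra. }
  assert (R1 : 17 / r <= 1 / sqrt r).
  { apply (proj2 (Rle_div_l _ _ r ltac:(lra))). rewrite <- Hsr at 2.
    replace (1 / sqrt r * (sqrt r * sqrt r)) with (sqrt r) by (field; lra). lra. }
  replace (11 / sqrt r) with (10 / sqrt r + 1 / sqrt r) by (field; lra).
  unfold mean_ln. apply Rabs_le_between in L0. apply Rabs_le. lra.
Qed.

Lemma R_0_mean_ln (m : nat) (d : R) : (1 <= m)%nat -> 0 < d ->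
  R_0 (2 * m + 1) d
  = 1 / ln (INR (2 * m + 1)) * (ln (INR (2 * m + 1)) - 1/2 - mean_ln m d).
Proof.
  intros Hm Hd; unfold R_0, mean_ln; f_equal.
  assert (Hq : 0 < INR (2 * m + 1)) by (apply lt_0_INR; lia).
  assert (C := fun x => continuous_ln_mom_0 m d x Hd).
  rewrite (RInt_ext_le _ (fun x => - ln (INR (2 * m + 1)) + ln (mom m 0 d x))).
  - rewrite RInt_plus_cont, RInt_cst by (cont; apply C). field.
  - lra.
  - intros x Hx. rewrite g_mom by (auto; lra).
    rewrite ln_mult, ln_Rinv; auto using Rinv_0_lt_compat, mom_0_gt0.
Qed.

Lemma abs_exp_minus_1_le (y : R) : Rabs y <= 1/2 -> Rabs (exp y - 1) <= 2 * Rabs y.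
Proof.
  intros Hy. assert (H1 := exp_ineq1_le y). assert (H2 := exp_ineq1_le (- y)).
  rewrite exp_Ropp in H2. assert (H3 := exp_pos y).
  assert (H4 : (1 - y) * exp y <= 1).
  { replace 1 with (/ exp y * exp y) at 2 by (field; lra). apply Rmult_le_compat_r; lra. }
  apply Rabs_le_between in Hy.
  assert (H5 := Rle_abs y). assert (H6 := Rle_abs (- y)). rewrite Rabs_Ropp in H6.
  assert (H7 := Rabs_pos y).
  apply Rabs_le; split; [lra|].
  destruct (Rle_or_lt 0 y); nra.
Qed.

(** With y the error in the mean of ln S, q^(2(R_0 - 1)) equals exp(-1 - 2y)/(2 pi d) exactly, so d
    cancels. The constant is 44 = 2 * 2 * 11. *)
Lemma is_d0_G_infty (m : nat) (d : R) : 20000 <= INR m -> is_d0 (2 * m + 1) d ->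
  Rabs (G_infty (2 * m + 1) d - 1 / (2 * PI * exp 1)) <= 44 / sqrt (INR m + 1/2).
Proof.
  intros Hm H0. assert (Hd : 0 < d) by apply H0.
  assert (Hm1 : (1 <= m)%nat) by (apply INR_le; simpl; lra).
  assert (L := is_d0_mean_ln m d Hm H0).
  set (y := mean_ln m d - ln (2 * PI * d) / 2) in *.
  assert (Hpi : 1 < PI) by (assert (H := PI2_1); lra).
  assert (He : 1 <= exp 1) by (assert (H := exp_ineq1_le 1); lra).
  assert (Hq : 0 < ln (INR (2 * m + 1))).
  { rewrite <- ln_1. apply ln_increasing; [lra|]. rewrite INR_odd; lra. }
  assert (E : G_infty (2 * m + 1) d = 1 / (2 * PI * exp 1) * exp (- 2 * y)).
  { unfold G_infty, Rpower. rewrite R_0_mean_ln by assumption.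
    replace (2 * (1 / ln (INR (2 * m + 1)) * (ln (INR (2 * m + 1)) - 1 / 2 - mean_ln m d) - 1)
             * ln (INR (2 * m + 1))) with (- ln (2 * PI * d) + (- (1) + - 2 * y))
      by (unfold y; field; lra).
    rewrite !exp_plus, !exp_Ropp, exp_ln by nra. field; repeat split; try lra. }
  rewrite E.
  replace (1 / (2 * PI * exp 1) * exp (- 2 * y) - 1 / (2 * PI * exp 1))
    with (1 / (2 * PI * exp 1) * (exp (- 2 * y) - 1)) by ring.
  assert (Hsr0 : 100 <= sqrt (INR m + 1/2)).
  { replace 100 with (sqrt (100 * 100)) by (apply sqrt_square; lra).
    apply sqrt_le_1_alt; lra. }
  assert (R2 : 0 < / sqrt (INR m + 1/2) <= /100)
    by (split; [apply Rinv_0_lt_compat|apply Rinv_le_contravar]; lra).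
  assert (E2 : Rabs (- 2 * y) <= 22 / sqrt (INR m + 1/2)).
  { rewrite Rabs_mult, Rabs_left by lra. unfold Rdiv in *; lra. }
  assert (A := abs_exp_minus_1_le (- 2 * y) ltac:(unfold Rdiv in *; lra)).
  assert (B : 0 < 1 / (2 * PI * exp 1) <= 1).
  { split; [apply Rdiv_lt_0_compat; nra|].
    apply (proj2 (Rle_div_l _ _ (2 * PI * exp 1) ltac:(nra))). nra. }
  rewrite Rabs_mult, (Rabs_pos_eq (1 / _)) by lra.
  assert (H := Rabs_pos (exp (- 2 * y) - 1)). unfold Rdiv in *; nra.
Qed.

(** Multiplied by ln q, the difference is -1/2 - ln(t)/2 up to the error in the mean of ln S, where
    t = 2 pi d/q. The window for d confines t to [1/20, 16], so this stays bounded. *)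
Lemma is_d0_R_0 (m : nat) (d : R) : 20000 <= INR m -> is_d0 (2 * m + 1) d ->
  Rabs (R_0 (2 * m + 1) d - 1/2) <= 30 / ln (INR (2 * m + 1)).
Proof.
  intros Hm H0. assert (Hd : 0 < d) by apply H0.
  assert (Hm1 : (200 <= m)%nat) by (apply INR_le; simpl; lra).
  assert (L := is_d0_mean_ln m d Hm H0).
  assert (HdU := is_d0_lt m d Hm1 H0). assert (HdL := is_d0_gt m d Hm H0).
  assert (Hq : 0 < ln (INR (2 * m + 1))).
  { rewrite <- ln_1. apply ln_increasing; [lra|]. rewrite INR_odd; lra. }
  assert (Hsr0 : 100 <= sqrt (INR m + 1/2)).
  { replace 100 with (sqrt (100 * 100)) by (apply sqrt_square; lra).
    apply sqrt_le_1_alt; lra. }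
  assert (R2 : 0 < / sqrt (INR m + 1/2) <= /100)
    by (split; [apply Rinv_0_lt_compat|apply Rinv_le_contravar]; lra).
  rewrite R_0_mean_ln by (assumption || lia).
  rewrite <- INR_odd in HdU, HdL. set (q := INR (2 * m + 1)) in *.
  assert (Hq0 : 0 < q) by lra.
  assert (Hpi : 1 < PI) by (assert (H := PI2_1); lra). assert (Hpi4 := PI_4).
  set (t := 2 * PI * (d / q)).
  assert (Hdq : / 40 <= d / q <= 2).
  { split; [apply (proj1 (Rle_div_r _ _ q Hq0))|apply (proj2 (Rle_div_l _ _ q Hq0))]; lra. }
  assert (Ht : / 20 <= t <= 16) by (unfold t; nra).
  assert (Elt : ln (2 * PI * d) = ln t + ln q).
  { rewrite <- ln_mult by lra. f_equal. unfold t; field; lra. }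
  rewrite Elt in L. apply Rabs_le_between in L.
  assert (Lt1 : ln t <= 15).
  { rewrite <- (ln_exp 15). apply Rcomplements.ln_le; [lra|].
    assert (H := exp_ineq1_le 15); lra. }
  assert (Lt2 : - 19 <= ln t).
  { rewrite <- (ln_exp (- 19)). apply Rcomplements.ln_le; [apply exp_pos|].
    replace (-19) with (- (19)) by ring. rewrite exp_Ropp. apply Rle_trans with (/ 20); [|lra].
    assert (H := exp_ineq1_le 19). apply Rinv_le_contravar; lra. }
  replace (1 / ln q * (ln q - 1 / 2 - mean_ln m d) - 1 / 2)
    with ((ln q / 2 - 1 / 2 - mean_ln m d) * / ln q) by (field; lra).
  change (30 / ln q) with (30 * / ln q). rewrite Rabs_mult, (Rabs_pos_eq (/ ln q))
    by (left; now apply Rinv_0_lt_compat).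
  apply Rmult_le_compat_r; [left; now apply Rinv_0_lt_compat|].
  apply Rabs_le; unfold Rdiv in *; lra.
Qed.

Lemma prime_nat_odd (q : nat) : prime_nat q -> (2 < q)%nat -> exists m, q = (2 * m + 1)%nat.
Proof.
  intros Hp Hq. destruct (Nat.Even_or_Odd q) as [[m E]|[m E]]; [exfalso|now exists m].
  assert (D : (2 | Z.of_nat q)%Z) by (exists (Z.of_nat m); lia).
  apply prime_divisors in D; [|exact Hp]. lia.
Qed.

Lemma filterlim_primes (f : nat -> R) (l : R) (B : R -> R) :
  (forall m, 20000 <= INR m -> prime_nat (2 * m + 1) ->
     Rabs (f (2 * m + 1)%nat - l) <= B (INR (2 * m + 1))) ->
  (forall eps : posreal, exists M, forall x, M < x -> B x < eps) ->
  filterlim f primes_to_infty (locally l).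
Proof.
  intros Hf HB. apply filterlim_locally; intros eps.
  destruct (HB eps) as [M HM].
  (* 40001 = 2 * 20000 + 1, so q > 40001 gives m > 20000. *)
  destruct (nfloor_ex (Rmax M 40001)) as [N [_ HN]].
  { apply Rle_trans with 40001; [lra|apply Rmax_r]. }
  exists (N + 1)%nat; intros q Hq Hp.
  assert (Hx : Rmax M 40001 < INR q).
  { apply le_INR in Hq. rewrite plus_INR in Hq. simpl in Hq. lra. }
  assert (Hx1 := Rmax_l M 40001). assert (Hx2 := Rmax_r M 40001).
  destruct (prime_nat_odd q Hp) as [m E].
  { apply INR_lt; simpl; lra. }
  subst q. eapply Rle_lt_trans; [apply (Hf m); [|exact Hp]|apply HM; lra].
  rewrite INR_odd in Hx; lra.
Qed.

Theorem corollary1 (d0 : nat -> R)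
  (Hd0 : forall q : nat, prime_nat q -> is_d0 q (d0 q)) :
  filterlim (fun q => G_infty q (d0 q)) primes_to_infty
            (locally (1 / (2 * PI * exp 1))) /\
  filterlim (fun q => R_0 q (d0 q)) primes_to_infty (locally (1 / 2)).
Proof.
  split.
  - apply (filterlim_primes _ _ (fun x => 44 / sqrt (x / 2))).
    + intros m Hm Hp. replace (INR (2 * m + 1) / 2) with (INR m + 1/2) by (rewrite INR_odd; field).
      apply is_d0_G_infty; auto.
    + intros eps; exists (2 * (44 / eps) ^ 2); intros x Hx.
      assert (He := cond_pos eps).
      assert (Ha : 0 < 44 / eps) by (apply Rdiv_lt_0_compat; lra).
      assert (Hs : 44 / eps < sqrt (x / 2)).
      { rewrite <- (sqrt_pow2 (44 / eps)) by lra. apply sqrt_lt_1_alt. nra. }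
      apply (proj2 (Rlt_div_l _ _ (sqrt (x / 2)) ltac:(lra))).
      apply (Rmult_lt_compat_l eps) in Hs; [|exact He].
      replace (eps * (44 / eps)) with 44 in Hs by (field; lra). exact Hs.
  - apply (filterlim_primes _ _ (fun x => 30 / ln x)).
    + intros m Hm Hp. apply is_d0_R_0; auto.
    + intros eps; exists (exp (30 / eps)); intros x Hx.
      assert (He := cond_pos eps).
      assert (Ha : 0 < 30 / eps) by (apply Rdiv_lt_0_compat; lra).
      assert (Hs : 30 / eps < ln x).
      { rewrite <- (ln_exp (30 / eps)). apply ln_increasing; [apply exp_pos|exact Hx]. }
      apply (proj2 (Rlt_div_l _ _ (ln x) ltac:(lra))).
      apply (Rmult_lt_compat_l eps) in Hs; [|exact He].
      replace (eps * (30 / eps)) with 30 in Hs by (field; lra). exact Hs.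
Qed.
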